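(* Let $G=(V,E)$ be a finite simple graph with $m=|E|$ edges, and let $$\mathcal P_{FM}=\{x\in\mathbb R^{E}:\ x(\delta(v))\le 1\ \ \forall v\in V,\ \ x\ge 0\}$$ be its fractional matching polytope. Then the (combinatorial) diameter of $\mathcal P_{FM}$ equals $$\max_{x\in \mathrm{vert}(\mathcal P_{FM})}\Big\{\mathbf 1^T x+\frac{|\mathcal C_x|}{2}\Big\},$$ where $\mathrm{vert}(\mathcal P_{FM})$ is the set of vertices of $\mathcal P_{FM}$ and, for a vertex $x$, $\mathcal C_x$ is the set of (node-disjoint odd) cycles formed by the edges $e$ with $x_e=\tfrac12$.
   Context: For $v\in V$, $\delta(v)$ is the set of edges incident to $v$, and for $F\subseteq E$, $x(F)=\sum_{e\in F}x_e$. The combinatorial diameter of a polytope is the maximum, over pairs of vertices, of the shortest-path distance between them in the 1-skeleton (the graph whose nodes are the vertices of the polytope and whose edges are its 1-dimensional faces). It is a known fact that every vertex $x$ of $\mathcal P_{FM}$ has all coordinates in $\{0,\tfrac12,1\}$, the edges with $x_e=1$ form a matching, and the edges with $x_e=\tfrac12$ form a collection of node-disjoint odd cycles; $\mathcal C_x$ denotes this collection of cycles and $|\mathcal C_x|$ its number. *)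

(* Defs.v *)
From HB Require Import structures.
From mathcomp Require Import all_boot all_order all_algebra.
From mathcomp Require Import boolp classical_sets reals.

Set Implicit Arguments.
Unset Strict Implicit.
Unset Printing Implicit Defensive.

Import Order.TTheory GRing.Theory Num.Theory.
Local Open Scope ring_scope.

(* Coordinate space R^E; the codomain is R^o so that the type is a vectType
   over R and [free] applies. *)
Notation vect R E := {ffun E -> R^o}.

Definition dotp (R : realType) (E : finType) (c x : vect R E) : R :=
  \sum_(i : E) c i * x i.

(* The improper faces set0 and P are included. *)
Definition is_face (R : realType) (E : finType) (P F : set (vect R E)) : Prop :=
  exists (c : vect R E) (b : R),
    (forall x, P x -> dotp c x <= b) /\
    F = [set x | P x /\ dotp c x = b]%classic.

Definition aff_indep (R : realType) (E : finType) (s : seq (vect R E)) : bool :=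
  if s is x0 :: s' then free [seq y - x0 | y <- s'] else true.

(* The affine dimension of S is k: the maximal size of an affinely independent
   family of points of S is k + 1. *)
Definition has_dim (R : realType) (E : finType) (S : set (vect R E)) (k : nat)
    : Prop :=
  (exists s : seq (vect R E),
     [/\ size s = k.+1, (forall y, y \in s -> S y) & aff_indep s]) /\
  (forall s : seq (vect R E),
     (forall y, y \in s -> S y) -> aff_indep s -> (size s <= k.+1)%N).

Definition is_vertex (R : realType) (E : finType) (P : set (vect R E))
    (v : vect R E) : Prop :=
  is_face P [set v]%classic.

Definition skel_adj (R : realType) (E : finType) (P : set (vect R E))
    (u v : vect R E) : Prop :=
  [/\ is_vertex P u, is_vertex P v, u <> v &
      exists F : set (vect R E), [/\ is_face P F, has_dim F 1, F u & F v]].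

Definition skel_walk (R : realType) (E : finType) (P : set (vect R E))
    (u v : vect R E) (n : nat) : Prop :=
  exists p : seq (vect R E),
    [/\ path (fun x y => `[< skel_adj P x y >]) u p, last u p = v & size p = n].

Definition skel_dist (R : realType) (E : finType) (P : set (vect R E))
    (u v : vect R E) (n : nat) : Prop :=
  skel_walk P u v n /\ (forall k, skel_walk P u v k -> (n <= k)%N).

Definition is_comb_diameter (R : realType) (E : finType) (P : set (vect R E))
    (d : nat) : Prop :=
  (exists u v, [/\ is_vertex P u, is_vertex P v & skel_dist P u v d]) /\
  (forall u v, is_vertex P u -> is_vertex P v ->
     exists2 k, skel_dist P u v k & (k <= d)%N).

Definition is_max_over (R : realType) (T : Type) (A : set T) (f : T -> R) (M : R)
    : Prop :=
  (exists2 x, A x & f x = M) /\ (forall x, A x -> f x <= M).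

Definition edge_set (V : finType) (adj : rel V) : {set {set V}} :=
  [set [set p.1; p.2] | p in [pred p : V * V | adj p.1 p.2]].

Notation edge adj := {A | A \in edge_set adj}.

Definition frac_matching_polytope (R : realType) (V : finType) (adj : rel V)
    : set (vect R (edge adj)) :=
  [set x : vect R (edge adj) |
     (forall v : V, (\sum_(e : edge adj | v \in val e) x e : R) <= 1) /\
     (forall e : edge adj, (0 : R) <= x e)]%classic.

(* A cycle of the graph, as a set of edges: the edges joining cyclically
   consecutive nodes of a duplicate-free sequence of at least three nodes. *)
Definition is_cycle (V : finType) (adj : rel V) (C : {set edge adj}) : Prop :=
  exists c : seq V,
    [/\ (2 < size c)%N, ucycle adj c &
        [set val e | e in C] = [set [set v; next c v] | v in c]].

(* C_x. When x is a vertex of the fractional matching polytope its 1/2-edges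
   form node-disjoint odd cycles, so these cycles are all of them. *)
Definition half_cycles (R : realType) (V : finType) (adj : rel V)
    (x : vect R (edge adj)) : {set {set edge adj}} :=
  [set C : {set edge adj} |
     (C \subset [set e | x e == 2^-1]) && `[< is_cycle C >]].

(* Main.v *)
Require Import Defs.
From HB Require Import structures.
From mathcomp Require Import boolp classical_sets reals.
From mathcomp Require Import all_boot all_order all_algebra all_fingroup.
From mathcomp Require Import zify ring lra.

Set Implicit Arguments.
Unset Strict Implicit.
Unset Printing Implicit Defensive.

Import Order.TTheory GRing.Theory Num.Theory.
Local Open Scope ring_scope.

(** A vertex of the polytope is encoded by a permutation [s] of the nodes all of
    whose cycles have length 1, 2 or an odd length: fixed points are exposed
    nodes, 2-cycles are edges of value 1 and the other cycles are the cycles of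
    half-edges. Hall's theorem, applied to the doubly stochastic matrix obtained
    by putting the slacks on the diagonal, shows that every vertex arises in this
    way. Two vertices are adjacent iff the directions supported on the union of
    their supports that vanish on the nodes tight in both form a line.

    Lower bound: counting edges and nodes of the component on which two adjacent
    vertices differ shows that [1^T x + |C_x|/2] grows by at most 1 along an edge
    of the polytope, so the distance from 0 to [x] is at least this number.

    Upper bound: by induction on a set [W] of nodes outside of which the two
    vertices [s] and [t] agree. One finds a nonempty [S] in [W] and [k] steps,
    distributed over both ends, after which the two vertices agree on [S], such
    that some vertex supported on [S] has value at least [k]. Any single graph
    edge that is not a chord of a cycle of [s] can be turned into an edge of
    value 1 in one step. Hence [S] can be an edge of value 1 of one vertex,
    unless it is a chord of a cycle of the other one. If only chords are left,
    take a cycle of [t] with a node outside the cycles of [s], break it there and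
    let [s] absorb the resulting matching (if this fails because of a cycle of
    [s], two suitable edges can be made common in two steps). If there is no such
    cycle either, all nodes of [W] lie on cycles of both vertices and [S = W]
    works. *)

(** * Orbits of permutations *)

Section Orbits.
Variable V : finType.
Implicit Types (s t : {perm V}) (A : {set V}).

Lemma porbit_step s v : porbit s (s v) = porbit s v.
Proof. by have := porbit_perm s 1 v; rewrite expg1. Qed.

Lemma mem_porbit_step s u v : (s u \in porbit s v) = (u \in porbit s v).
Proof. by rewrite -!eq_porbit_mem porbit_step. Qed.

Lemma mem_porbit1 s v : s v \in porbit s v.
Proof. by rewrite mem_porbit_step porbit_id. Qed.

Lemma mem_porbit_inv s u v : (s^-1%g u \in porbit s v) = (u \in porbit s v).
Proof. by rewrite -mem_porbit_step permKV. Qed.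

Lemma porbit_trans s u v : u \in porbit s v -> porbit s u = porbit s v.
Proof. by rewrite -eq_porbit_mem => /eqP. Qed.

Lemma porbit_sub s A v :
  (forall u, u \in A -> s u \in A) -> v \in A -> porbit s v \subset A.
Proof.
move=> cA vA; apply/subsetP => u /porbitP [i ->].
by elim: i => [|i IH]; rewrite ?expg0 ?perm1 // expgSr permM; apply: cA.
Qed.

Lemma porbit_sub_on s t A v :
  (forall u, u \in A -> s u \in A) -> (forall u, u \in A -> s u \in porbit t u) ->
  v \in A -> porbit s v \subset porbit t v.
Proof.
move=> cA st vA; suff : porbit s v \subset A :&: porbit t v.
  by move=> /subset_trans; apply; rewrite subsetIr.
apply: porbit_sub => [u|]; rewrite !inE ?vA ?porbit_id // => /andP [uA uv].
by rewrite cA //= -(porbit_trans uv) st.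
Qed.

Lemma porbit_eq_on s t A v :
  (forall u, u \in A -> s u \in A) -> {in A, s =1 t} -> v \in A ->
  porbit s v = porbit t v.
Proof.
move=> cA st vA; apply/eqP; rewrite eqEsubset; apply/andP; split.
  by apply: (porbit_sub_on cA) => // u uA; rewrite st ?mem_porbit1.
apply: (@porbit_sub_on _ _ A) => // u uA; first by rewrite -st ?cA.
by rewrite -st ?mem_porbit1.
Qed.

Lemma card_porbit_gt0 s v : (0 < #|porbit s v|)%N.
Proof. by rewrite lt0n card_porbit_neq0. Qed.

Lemma porbit_iter s v u : u \in porbit s v ->
  exists2 i, (i < #|porbit s v|)%N & u = iter i s v.
Proof.
rewrite porbit_traject => /trajectP [i lti ->]; by exists i.
Qed.

Lemma iter_mem_porbit s v i : iter i s v \in porbit s v.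
Proof. by elim: i => [|i IH] /=; rewrite ?porbit_id // mem_porbit_step. Qed.

Lemma iter_porbit_inj s v i j :
  (i < #|porbit s v|)%N -> (j < #|porbit s v|)%N ->
  iter i s v = iter j s v -> i = j.
Proof.
move=> lti ltj eq; have := uniq_traject_porbit s v.
move/(nth_uniq v); rewrite size_traject => /(_ i j lti ltj).
by rewrite !nth_traject // eq eqxx => /esym /eqP.
Qed.

Lemma card_porbit_le1 s v : (#|porbit s v| <= 1)%N = (s v == v).
Proof.
apply/idP/eqP => [le1|fx]; last first.
  rewrite -(cards1 v) subset_leq_card //; apply: porbit_sub => [u|].
    by rewrite !inE => /eqP ->; rewrite fx.
  by rewrite inE.
have /card_le1P := le1 => /(_ v (porbit_id s v)) /(_ (s v)).
by rewrite mem_porbit1 inE => /esym /eqP.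
Qed.

Lemma card_porbit_le2 s v : (#|porbit s v| <= 2)%N = (s (s v) == v).
Proof.
apply/idP/eqP => [le2|fx].
  have := iter_porbit s v; have := card_porbit_gt0 s v.
  case E : #|porbit s v| le2 => [|[|[|n]]] // _ _ /= eq; by rewrite !eq.
apply: (@leq_trans #|[set v; s v]|); last by rewrite cards2; case: eqP.
apply/subset_leq_card/porbit_sub; last by rewrite !inE eqxx.
by move=> u; rewrite !inE => /orP [] /eqP ->; rewrite ?fx eqxx ?orbT.
Qed.

Lemma sfix_porbit s u v : u \in porbit s v -> (s u == u) = (s v == v).
Proof. by move=> uv; rewrite -!card_porbit_le1 (porbit_trans uv). Qed.

Lemma sinv_porbit s u v : u \in porbit s v -> (s (s u) == u) = (s (s v) == v).
Proof. by move=> uv; rewrite -!card_porbit_le2 (porbit_trans uv). Qed.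

Lemma porbit_pair s v : s (s v) = v -> porbit s v = [set v; s v].
Proof.
move=> fx; apply/eqP; rewrite eqEsubset; apply/andP; split.
  apply: porbit_sub; last by rewrite !inE eqxx.
  by move=> u; rewrite !inE => /orP [] /eqP ->; rewrite ?fx eqxx ?orbT.
by apply/subsetP => u; rewrite !inE => /orP [] /eqP ->; rewrite ?porbit_id ?mem_porbit1.
Qed.

(** Going once around an odd orbit returns to [v] with the opposite sign. This is what turns zero
    row sums on an odd cycle into zero entries. *)
Lemma odd_alternate_eq0 (R : numFieldType) s v (g : V -> R) :
  odd #|porbit s v| -> (forall u, u \in porbit s v -> g (s u) = - g u) -> g v = 0.
Proof.
move=> on alt; suff H i : g (iter i s v) = (-1) ^+ i * g v.
  have := H #|porbit s v|; rewrite iter_porbit -signr_odd on expr1 mulN1r => /eqP.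
  by rewrite -addr_eq0 -mulr2n mulrn_eq0 /= => /eqP.
elim: i => [|i IH] /=; first by rewrite mul1r.
by rewrite alt ?iter_mem_porbit // IH exprS mulN1r mulNr.
Qed.

Lemma odd_not_alternate s v (c : pred V) : odd #|porbit s v| ->
  exists2 u, u \in porbit s v & c (s u) = c u.
Proof.
move=> on; suff /exists_inP [u uv /eqP E] : [exists u in porbit s v, c (s u) == c u] by exists u.
apply: contraT; rewrite negb_exists_in => /forall_inP H.
suff E i : c (iter i s v) = odd i (+) c v.
  by have := E #|porbit s v|; rewrite iter_porbit on; case: (c v).
elim: i => [|i IH] //=.
have := H _ (iter_mem_porbit s v i); rewrite IH.
by case: (odd i) (c v) (c _) => [] [] [].
Qed.

(** * Exposing a node of a cycle *)

Section Remove.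
Variables (s : {perm V}) (a : V).
Let n := #|porbit s a|.

(** The involution on positions along the orbit that swaps 1 with 2, 3 with 4, and so on. Position 0
    stays fixed because [0.-1 = 0]; for even [n] so does the last position, which has no partner. *)
Definition mate_index i :=
  if odd i then (if i.+1 < n then i.+1 else i)%N else i.-1.

Definition expose_fun v :=
  if v \in porbit s a then iter (mate_index (index v (traject s a n))) s a else s v.

Lemma expose_fun_iter i : (i < n)%N -> expose_fun (iter i s a) = iter (mate_index i) s a.
Proof.
move=> lti; rewrite /expose_fun iter_mem_porbit; congr iter; congr mate_index.
by rewrite -(nth_traject s lti) index_uniq ?size_traject ?uniq_traject_porbit.
Qed.

Lemma mate_index_lt i : (i < n)%N -> (mate_index i < n)%N.
Proof.
move=> lti; rewrite /mate_index; case: ifP => _; first by case: ifP.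
exact: leq_ltn_trans (leq_pred i) lti.
Qed.

Lemma mate_indexK i : (i < n)%N -> mate_index (mate_index i) = i.
Proof.
move=> lti; rewrite {2}/mate_index; case oi: (odd i).
  by case h: (i.+1 < n)%N; rewrite /mate_index /= oi ?h.
by case: i oi lti => [|i] //= oi lti; rewrite /mate_index (negbFE oi) lti.
Qed.

Lemma expose_funK v : v \in porbit s a -> expose_fun (expose_fun v) = v.
Proof.
move=> /porbit_iter [i lti ->]; rewrite expose_fun_iter //.
by rewrite expose_fun_iter ?mate_indexK ?mate_index_lt.
Qed.

Lemma mem_expose_fun v : (expose_fun v \in porbit s a) = (v \in porbit s a).
Proof. by rewrite {1}/expose_fun; case: ifP => [|h]; rewrite ?iter_mem_porbit ?mem_porbit_step. Qed.

Lemma expose_fun_inj : injective expose_fun.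
Proof.
move=> u v eq; have := congr1 (mem (porbit s a)) eq; rewrite /= !mem_expose_fun.
case: (boolP (v \in porbit s a)) => [vP uP|vP uP].
  by rewrite -(expose_funK uP) eq expose_funK.
by move: eq; rewrite /expose_fun uP (negbTE vP) => /perm_inj.
Qed.

(* Delete [a] from its cycle and match the other nodes of the cycle in
   consecutive pairs, starting with the successor of [a]. *)
Definition expose : {perm V} := perm expose_fun_inj.

Lemma expose_iter i : (i < n)%N -> expose (iter i s a) = iter (mate_index i) s a.
Proof. by rewrite permE; apply: expose_fun_iter. Qed.

Lemma expose_self : expose a = a.
Proof. by rewrite (@expose_iter 0) // card_porbit_gt0. Qed.

Lemma expose_out v : v \notin porbit s a -> expose v = s v.
Proof. by move=> vP; rewrite permE /expose_fun (negbTE vP). Qed.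

Lemma mem_expose v : (expose v \in porbit s a) = (v \in porbit s a).
Proof. by rewrite permE mem_expose_fun. Qed.

Lemma exposeK v : v \in porbit s a -> expose (expose v) = v.
Proof. by rewrite !permE; apply: expose_funK. Qed.

Lemma expose_neighbour v : [\/ expose v = v, expose v = s v | expose v = s^-1%g v].
Proof.
case: (boolP (v \in porbit s a)) => [/porbit_iter [i lti ->]|/expose_out ->]; last by constructor 2.
rewrite expose_iter //= /mate_index; case: ifP => oi.
  by case: ifP => h; [constructor 2 | constructor 1].
case: i lti oi => [|i] _ _; first by constructor 1.
by constructor 3; rewrite iterS permK.
Qed.

(** For odd [n] the positions from 1 to [n - 1] are even in number, so only position 0 stays
    unpaired. *)
Lemma expose_fixed v : odd n -> v \in porbit s a -> expose v = v -> v = a.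
Proof.
move=> on /porbit_iter [i lti ->]; rewrite expose_iter // => /iter_porbit_inj.
move/(_ (mate_index_lt lti) lti); rewrite /mate_index.
case: ifP => oi; last by case: i oi {lti} => [|i] //= _; lia.
case: ifP => h; first by lia.
have en : n = i.+1 by apply/eqP; rewrite eqn_leq lti andbT leqNgt h.
by move: on; rewrite en /= oi.
Qed.

Lemma expose_small v : s (s a) = a -> v \in porbit s a -> expose v = v.
Proof.
move=> /eqP; rewrite -card_porbit_le2 => n2 /porbit_iter [i lti ->].
by rewrite expose_iter // /mate_index; case: i lti => [|[|i]] //=; [case: ifP => //|]; rewrite /n; lia.
Qed.

Lemma expose_next : s (s a) != a -> expose (s a) = s (s a).
Proof.
rewrite -card_porbit_le2 -ltnNge => n2; rewrite (@expose_iter 1) /mate_index /=; last by rewrite /n; lia.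
by rewrite n2.
Qed.

Lemma expose_prev : odd n -> s (s a) != a -> expose (s^-1%g a) = s^-1%g (s^-1%g a).
Proof.
rewrite -card_porbit_le2 -ltnNge => on n2.
have E : iter n s a = a by apply: iter_porbit.
have [m En] : exists m, n = m.+3 by exists (n - 3)%N; rewrite /n; lia.
have E1 : s^-1%g a = iter m.+2 s a by rewrite -{1}E En iterS permK.
have om : odd m = false by move: on; rewrite -/n En /= negbK; case: odd.
by rewrite E1 expose_iter /mate_index ?En //= om /= permK.
Qed.

End Remove.
End Orbits.

(** * Configurations *)

Section Configurations.
Variables (R : realType) (V : finType) (adj : rel V).
Implicit Types (s t r : {perm V}) (A W : {set V}).

(** The condition depends only on the orbit of [v], so it can be checked separately on complementary
    closed sets. The alternative [s (s v) == v] covers both fixed points and 2-cycles. *)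
Definition conf_at s v :=
  ((s v == v) || adj v (s v)) && ((s (s v) == v) || odd #|porbit s v|).

(* The orientation of the long cycles is arbitrary, so that several
   configurations may encode the same vertex. *)
Definition conf s := [forall v, conf_at s v].

(* [1^T x + |C_x|/2] spread evenly over the nodes of each cycle of length [m]. *)
Definition weight (m : nat) : R :=
  if (m <= 1)%N then 0 else if (m <= 2)%N then 2^-1 else (1 + m%:R^-1) / 2.

Definition score s : R := \sum_v weight #|porbit s v|.

Lemma scoreE s : score s = \sum_v weight #|porbit s v|.
Proof. by []. Qed.

Lemma conf_adj s v : conf s -> s v != v -> adj v (s v).
Proof. by move=> /forallP /(_ v) /andP [/orP [/eqP ->|//]]; rewrite eqxx. Qed.

Lemma conf_odd s v : conf s -> s (s v) != v -> odd #|porbit s v|.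
Proof. by move=> /forallP /(_ v) /andP [_ /orP [/eqP ->|//]]; rewrite eqxx. Qed.

Lemma conf1 : conf 1%g.
Proof. by apply/forallP => v; rewrite /conf_at !perm1 !eqxx. Qed.

Lemma mem_closed s W v : (forall u, u \in W -> s u \in W) -> (s v \in W) = (v \in W).
Proof.
move=> cW; apply/idP/idP => [svW|/cW //].
have /subsetP := porbit_sub cW svW; apply.
by rewrite porbit_step porbit_id.
Qed.

Lemma mem_closed_inv s W v :
  (forall u, u \in W -> s u \in W) -> (s^-1%g v \in W) = (v \in W).
Proof. by move=> cW; rewrite -(mem_closed _ cW) permKV. Qed.

Lemma conf_at_eq_on s t A v :
  (forall u, u \in A -> s u \in A) -> {in A, s =1 t} -> v \in A ->
  conf_at s v = conf_at t v.
Proof.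
by move=> cA st vA; rewrite /conf_at (porbit_eq_on cA st vA) -!st ?cA.
Qed.

Lemma weight_eq_on s t A v :
  (forall u, u \in A -> s u \in A) -> {in A, s =1 t} -> v \in A ->
  weight #|porbit s v| = weight #|porbit t v|.
Proof. by move=> cA st vA; rewrite (porbit_eq_on cA st vA). Qed.

Lemma weight_fixed s v : s v = v -> weight #|porbit s v| = 0.
Proof. by move=> /eqP; rewrite -card_porbit_le1 /weight => ->. Qed.

Lemma weight_pair s v : s v != v -> s (s v) = v -> weight #|porbit s v| = 2^-1.
Proof.
by rewrite -card_porbit_le1 /weight => /negbTE -> /eqP; rewrite -card_porbit_le2 => ->.
Qed.

Lemma weight_cycle s v : s (s v) != v ->
  weight #|porbit s v| = (1 + #|porbit s v|%:R^-1) / 2.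
Proof.
rewrite -card_porbit_le2 /weight => h; rewrite (negbTE h).
by case: ifP => // h1; move: h; rewrite (leq_trans h1).
Qed.

Lemma weight_ge0 m : 0 <= weight m.
Proof.
rewrite /weight; case: ifP => // _; case: ifP => // _; rewrite ?invr_ge0 ?ler0n //.
by rewrite divr_ge0 ?addr_ge0 ?invr_ge0 ?ler0n.
Qed.

Lemma weight_ge_half m : (1 < m)%N -> 2^-1 <= weight m.
Proof.
rewrite /weight ltnNge => /negbTE ->; case: ifP => // _.
by rewrite mulrDl mul1r lerDl mulr_ge0 ?invr_ge0 ?ler0n.
Qed.

Lemma score1 : score 1%g = 0.
Proof. by apply: big1 => v _; rewrite weight_fixed // perm1. Qed.

Lemma closedC s W :
  (forall u, u \in W -> s u \in W) -> forall u, u \in ~: W -> s u \in ~: W.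
Proof. by move=> cW u; rewrite !inE mem_closed. Qed.

Lemma porbit_closed s v u : u \in porbit s v -> s u \in porbit s v.
Proof. by rewrite mem_porbit_step. Qed.

Lemma porbitC_closed s v u : u \in ~: porbit s v -> s u \in ~: porbit s v.
Proof. by rewrite !inE mem_porbit_step. Qed.

Lemma expose_eq_out s a : {in ~: porbit s a, s =1 expose s a}.
Proof. by move=> v; rewrite inE => /expose_out ->. Qed.

Section Symmetric.
Hypothesis adj_sym : symmetric adj.

Lemma conf_adj_inv s v : conf s -> s^-1%g v != v -> adj v (s^-1%g v).
Proof.
move=> cs nv; rewrite adj_sym -{2}(permKV s v); apply: conf_adj => //.
by rewrite permKV eq_sym.
Qed.

Lemma conf_expose s a : conf s -> conf (expose s a).
Proof.
move=> cs; apply/forallP => v; case: (boolP (v \in porbit s a)) => vP.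
  rewrite /conf_at exposeK // eqxx andbT; case: eqP => //= /eqP nv.
  case: (expose_neighbour s a v) => E; move: nv; rewrite E ?eqxx // => nv.
    exact: conf_adj.
  exact: conf_adj_inv.
have vC : v \in ~: porbit s a by rewrite inE.
rewrite -(conf_at_eq_on (@porbitC_closed s a) (@expose_eq_out s a) vC).
exact: (forallP cs).
Qed.

(** Applied when [t] fixes [a] and [b]: the product then gains the 2-cycle on [a] and [b] and is
    otherwise equal to [t]. *)
Definition link a b t : {perm V} := (tperm a b * t)%g.

Lemma linkL a b t : t b = b -> link a b t a = b.
Proof. by rewrite permM tpermL. Qed.

Lemma linkR a b t : t a = a -> link a b t b = a.
Proof. by rewrite permM tpermR. Qed.

Lemma linkD a b t v : v != a -> v != b -> link a b t v = t v.
Proof. by move=> va vb; rewrite permM tpermD // eq_sym. Qed.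

Lemma link_closed a b t : t a = a -> t b = b ->
  forall u, u \in ~: [set a; b] -> t u \in ~: [set a; b].
Proof.
move=> ta tb u; rewrite !inE !negb_or -{2}ta -{2}tb !(inj_eq perm_inj) //.
Qed.

Lemma link_eq_on a b t : {in ~: [set a; b], t =1 link a b t}.
Proof. by move=> v; rewrite !inE negb_or => /andP [va vb]; rewrite linkD. Qed.

Lemma conf_link a b t : conf t -> t a = a -> t b = b -> adj a b -> conf (link a b t).
Proof.
move=> ct ta tb ab; apply/forallP => v.
have [->|va] := eqVneq v a.
  by rewrite /conf_at linkL // linkR // ab !eqxx orbT.
have [->|vb] := eqVneq v b.
  by rewrite /conf_at linkR // linkL // adj_sym ab !eqxx orbT.
have vC : v \in ~: [set a; b] by rewrite !inE negb_or va.
rewrite -(conf_at_eq_on (link_closed ta tb) (@link_eq_on a b t) vC).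
exact: (forallP ct).
Qed.

Lemma score_link a b t : t a = a -> t b = b -> a != b ->
  score (link a b t) = score t + 1.
Proof.
move=> ta tb ab; have ba : b != a by rewrite eq_sym.
have wa : weight #|porbit (link a b t) a| = 2^-1 by rewrite weight_pair ?linkL ?linkR.
have wb : weight #|porbit (link a b t) b| = 2^-1 by rewrite weight_pair ?linkR ?linkL.
rewrite /score (bigD1 a) // (bigD1 b) //= [in RHS](bigD1 a) // [in RHS](bigD1 b) //=.
rewrite (weight_fixed ta) (weight_fixed tb) wa wb.
rewrite (eq_bigr (fun v => weight #|porbit t v|)); first by field.
move=> v /andP [va vb]; apply/esym.
apply: (weight_eq_on (link_closed ta tb) (@link_eq_on a b t)).
by rewrite !inE negb_or va.
Qed.

Lemma sum_weight_cycle s a : s (s a) != a ->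
  \sum_(v in porbit s a) weight #|porbit s v| = (#|porbit s a|%:R + 1) / 2.
Proof.
move=> ca; rewrite (eq_bigr (fun=> (1 + #|porbit s a|%:R^-1) / 2)); last first.
  by move=> v vP; rewrite (porbit_trans vP) weight_cycle.
rewrite big_const iter_addr_0 -mulr_natr; field.
by rewrite pnatr_eq0 -lt0n card_porbit_gt0.
Qed.

Lemma sum_weight_expose s a : odd #|porbit s a| ->
  \sum_(v in porbit s a) weight #|porbit (expose s a) v| = (#|porbit s a|%:R - 1) / 2.
Proof.
move=> on; rewrite (bigD1 a) ?porbit_id //= weight_fixed ?expose_self // add0r.
rewrite (eq_bigr (fun=> 2^-1)).
  rewrite (eq_bigl (mem (porbit s a :\ a))) => [|v]; last by rewrite !inE andbC.
  rewrite big_const iter_addr_0 -[LHS]mulr_natl; congr (_ * _).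
  by rewrite (cardsD1 a (porbit s a)) porbit_id natrD addrAC subrr add0r.
move=> v /andP [vP va]; rewrite weight_pair ?exposeK //.
by apply: contra va => /eqP /(expose_fixed on vP) ->.
Qed.

(** A cycle of odd length [n] contributes [(n + 1) / 2], the matching that replaces it
    [(n - 1) / 2], and all other orbits are unchanged. *)
Lemma score_expose s a : conf s -> s (s a) != a -> score (expose s a) = score s - 1.
Proof.
move=> cs ca; have on := conf_odd cs ca.
rewrite /score (bigID (mem (porbit s a))) /= [in RHS](bigID (mem (porbit s a))) /=.
rewrite sum_weight_cycle // sum_weight_expose //.
rewrite (eq_bigr (fun v => weight #|porbit s v|)); first by field.
move=> v vP; apply/esym.
by apply: (weight_eq_on (@porbitC_closed s a) (@expose_eq_out s a)); rewrite inE.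
Qed.

Lemma fixed_off_closed r W : (forall v, v \notin W -> r v = v) ->
  forall u, u \in W -> r u \in W.
Proof.
move=> fx u uW; apply: contraT => nW.
by have /perm_inj E := fx _ nW; move: nW; rewrite E uW.
Qed.

(** The factors move disjoint sets of nodes, so the cycles of the product are those of both factors.
    This combines the vertices that pay for successive stages of the upper bound. *)
Lemma conf_mul r r' W : conf r -> conf r' ->
  (forall v, v \notin W -> r v = v) -> (forall v, v \in W -> r' v = v) ->
  conf (r * r')%g /\ score (r * r')%g = score r + score r'.
Proof.
move=> cr cr' fr fr'; have clW := fixed_off_closed fr.
have clC : forall u, u \in ~: W -> r' u \in ~: W.
  by apply: fixed_off_closed => v; rewrite inE negbK; apply: fr'.
have eqW : {in W, r =1 (r * r')%g} by move=> v vW; rewrite permM fr' // clW.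
have eqC : {in ~: W, r' =1 (r * r')%g} by move=> v; rewrite inE => vW; rewrite permM fr.
split.
  apply/forallP => v; case: (boolP (v \in W)) => vW.
    by rewrite -(conf_at_eq_on clW eqW) ?(forallP cr).
  by rewrite -(conf_at_eq_on clC eqC) ?(forallP cr') ?inE.
rewrite /score -big_split /=; apply: eq_bigr => v _.
case: (boolP (v \in W)) => vW.
  by rewrite (weight_fixed (fr' _ vW)) addr0 (weight_eq_on clW eqW).
by rewrite (weight_fixed (fr _ vW)) add0r (weight_eq_on clC eqC) ?inE.
Qed.

Lemma conf_restrict t W : conf t -> (forall u, u \in W -> t u \in W) ->
  exists r, [/\ conf r, forall v, v \notin W -> r v = v &
                score r = \sum_(v in W) weight #|porbit t v|].
Proof.
move=> ct cW; pose f v := if v \in W then t v else v.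
have fi : injective f.
  move=> u v; rewrite /f; case: ifP => uW; case: ifP => vW //; first by move/perm_inj.
    by move=> E; move: vW; rewrite -E mem_closed ?uW.
  by move=> E; move: uW; rewrite E mem_closed ?vW.
have fr v : v \notin W -> perm fi v = v by rewrite permE /f => /negbTE ->.
have clW := fixed_off_closed fr.
have eqW : {in W, perm fi =1 t} by move=> v vW; rewrite permE /f vW.
exists (perm fi); split => //.
  apply/forallP => v; case: (boolP (v \in W)) => vW.
    by rewrite (conf_at_eq_on clW eqW) ?(forallP ct).
  by rewrite /conf_at fr // fr // !eqxx.
rewrite /score (bigID (mem W)) /= [X in _ + X]big1 ?addr0 => [|v vW].
  by apply: eq_bigr => v vW; rewrite (weight_eq_on clW eqW).
by rewrite weight_fixed ?fr.
Qed.

End Symmetric.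
End Configurations.

(** * Faces of the fractional matching polytope *)

Lemma set2_eq (T : finType) (a b c d : T) : [set a; b] = [set c; d] ->
  (a = c /\ b = d) \/ (a = d /\ b = c).
Proof.
move=> E.
have ha : a \in [set c; d] by rewrite -E set21.
have hb : b \in [set c; d] by rewrite -E set22.
have hc : c \in [set a; b] by rewrite E set21.
have hd : d \in [set a; b] by rewrite E set22.
move: ha hb hc hd; rewrite !inE.
by move=> /pred2P [->|->] /pred2P [->|->] /pred2P [] ? /pred2P [] ?; auto.
Qed.

Lemma finite_small_scale (R : realFieldType) (I : finType) (a b : I -> R) :
  (forall i, 0 < a i) -> (forall i, 0 <= b i) ->
  exists2 e, 0 < e & forall i, e * b i <= a i.
Proof.
move=> a0 b0; suff [e e0 H] : exists2 e, 0 < e & forall i, i \in enum I -> e * b i <= a i.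
  by exists e => // i; apply: H; rewrite mem_enum.
elim: (enum I) => [|i l [e e0 IH]]; first by exists 1.
have b1 : 0 < b i + 1 by rewrite ltr_wpDl.
(* The [+ 1] keeps the denominator positive when [b i = 0]. *)
exists (Num.min e (a i / (b i + 1))); first by rewrite lt_min e0 divr_gt0.
move=> j; rewrite inE => /orP [/eqP ->|jl]; last first.
  by apply: le_trans (IH j jl); rewrite ler_wpM2r // ge_min lexx.
apply: (@le_trans _ _ (a i / (b i + 1) * b i)).
  by rewrite ler_wpM2r // ge_min lexx orbT.
by rewrite mulrAC ler_pdivrMr // mulrDr mulr1 lerDl ltW.
Qed.

Section EdgeVectors.
Variables (R : realType) (V : finType) (adj : rel V).
Hypotheses (adj_sym : symmetric adj) (adj_irr : irreflexive adj).
Notation vec := (vect R (edge adj)).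
Implicit Types (x y z d : vec) (e : edge adj) (u v w : V).

(* The value of [d] on the edge between [u] and [v], and 0 if there is none. *)
Definition ev d u v : R := \sum_(e : edge adj | val e == [set u; v]) d e.
Definition deg d v : R := \sum_u ev d v u.

Lemma mem_edge_set u v : ([set u; v] \in edge_set adj) = adj u v.
Proof.
apply/imsetP/idP => [[[a b]] /= ab /set2_eq [] [-> ->] //|uv]; last by exists (u, v).
by rewrite adj_sym.
Qed.

Lemma edge_ends e : exists u v, adj u v /\ val e = [set u; v].
Proof. by have := valP e => /imsetP [[u v] /= uv E]; exists u, v. Qed.

Lemma ev_sym d u v : ev d u v = ev d v u.
Proof. by rewrite /ev setUC. Qed.

Lemma ev_edge d e u v : val e = [set u; v] -> ev d u v = d e.
Proof.
move=> E; rewrite /ev (big_pred1 e) // => f.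
by rewrite -E /= (inj_eq val_inj).
Qed.

Lemma ev_nadj d u v : ~~ adj u v -> ev d u v = 0.
Proof.
move=> n; rewrite /ev big_pred0 // => e; apply: contraNF n => /eqP E.
by rewrite -mem_edge_set -E (valP e).
Qed.

Lemma ev_diag d v : ev d v v = 0.
Proof. by rewrite ev_nadj ?adj_irr. Qed.

Lemma adj_edge u v : adj u v -> exists e : edge adj, val e = [set u; v].
Proof. by rewrite -mem_edge_set => h; exists (exist (fun A => A \in edge_set adj) _ h). Qed.

Lemma eq_ev d d' : (forall u v, adj u v -> ev d u v = ev d' u v) -> d = d'.
Proof.
move=> H; apply/ffunP => e; have [u [v [uv E]]] := edge_ends e.
by rewrite -!(ev_edge _ E) H.
Qed.

Lemma evD d d' u v : ev (d + d') u v = ev d u v + ev d' u v.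
Proof. by rewrite /ev -big_split; apply: eq_bigr => e _; rewrite ffunE. Qed.

Lemma evZ (c : R) d u v : ev (c *: d) u v = c * ev d u v.
Proof. by rewrite /ev mulr_sumr; apply: eq_bigr => e _; rewrite ffunE. Qed.

Lemma evN d u v : ev (- d) u v = - ev d u v.
Proof. by rewrite -scaleN1r evZ mulN1r. Qed.

Lemma degD d d' v : deg (d + d') v = deg d v + deg d' v.
Proof. by rewrite /deg -big_split; apply: eq_bigr => e _; rewrite evD. Qed.

Lemma degZ (c : R) d v : deg (c *: d) v = c * deg d v.
Proof. by rewrite /deg mulr_sumr; apply: eq_bigr => e _; rewrite evZ. Qed.

Lemma degN d v : deg (- d) v = - deg d v.
Proof. by rewrite -scaleN1r degZ mulN1r. Qed.

Lemma degE d v : deg d v = \sum_(e : edge adj | v \in val e) d e.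
Proof.
rewrite /deg /ev (exchange_big_dep predT) //= [RHS]big_mkcond /=.
apply: eq_bigr => e _; have [a [b [ab E]]] := edge_ends e.
have nab : a != b by apply: contraTneq ab => ->; rewrite adj_irr.
case: ifP => vE.
  move: vE; rewrite E !inE => /orP [] /eqP ->.
    rewrite (big_pred1 b) // => u /=; apply/eqP/eqP => [/set2_eq []|->] // [ea ->] //.
  rewrite (big_pred1 a) // => u /=; apply/eqP/eqP => [/set2_eq []|->] //; last exact: setUC.
    by move=> [-> ->].
  by case.
by rewrite big_pred0 // => u; apply: contraFF vE => /eqP ->; rewrite !inE eqxx.
Qed.

Lemma sum_deg d : \sum_v deg d v = 2 * \sum_e d e.
Proof.
under eq_bigr => v _ do rewrite degE.
rewrite (exchange_big_dep predT) //= mulr_sumr; apply: eq_bigr => e _.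
have [a [b [ab E]]] := edge_ends e.
have nab : a != b by apply: contraTneq ab => ->; rewrite adj_irr.
rewrite (eq_bigl (mem [set a; b])) => [|v]; last by rewrite E.
by rewrite big_setU1 ?inE //= big_set1 mulr2n mulrDl !mul1r.
Qed.

Notation P := (@frac_matching_polytope R V adj).

Lemma fmpP x : P x <-> (forall v, deg x v <= 1) /\ (forall e, 0 <= x e).
Proof. by split => -[h1 h2]; split => // v; have := h1 v; rewrite degE. Qed.

Lemma ev_ge0 x u v : P x -> 0 <= ev x u v.
Proof. by move=> /fmpP [_ h]; apply: sumr_ge0. Qed.

(* The directions in which [x] can be moved both ways inside the polytope. *)
Definition kernel x d :=
  (forall e, x e = 0 -> d e = 0) /\ (forall v, deg x v = 1 -> deg d v = 0).

(** Constraints tight at [x] are unaffected by [d]. Each of the finitely many others has positive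
    slack, so one small step length suits them all. *)
Lemma kernel_move x d : P x -> kernel x d ->
  exists2 c, 0 < c & P (x + c *: d) /\ P (x - c *: d).
Proof.
move=> /fmpP [px0 px1] [h1 h2].
have [c1 c10 H1] : exists2 c, 0 < c & forall e, c * `|d e| <= x e.
  have [|i|c c0 H] := @finite_small_scale R (edge adj)
    (fun e => if x e == 0 then 1 else x e) (fun e => `|d e|).
  - by move=> e; case: eqP => // /eqP ne; rewrite lt_def ne px1.
  - exact: normr_ge0.
  exists c => // e; have := H e; case: eqP => // xe _.
  by rewrite h1 // normr0 mulr0 xe.
have [c2 c20 H2] : exists2 c, 0 < c & forall v, c * `|deg d v| <= 1 - deg x v.
  have [|i|c c0 H] := @finite_small_scale R V
    (fun v => if deg x v == 1 then 1 else 1 - deg x v) (fun v => `|deg d v|).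
  - by move=> v; case: eqP => // /eqP ne; rewrite subr_gt0 lt_def eq_sym ne px0.
  - exact: normr_ge0.
  exists c => // v; have := H v; case: eqP => // xv _.
  by rewrite h2 // normr0 mulr0 xv subrr.
pose c := Num.min c1 c2; have c0 : 0 < c by rewrite lt_min c10.
have le1 e : `|c * d e| <= x e.
  rewrite normrM gtr0_norm //; apply: le_trans (H1 e).
  by rewrite ler_wpM2r // ge_min lexx.
have le2 v : `|c * deg d v| <= 1 - deg x v.
  rewrite normrM gtr0_norm //; apply: le_trans (H2 v).
  by rewrite ler_wpM2r // ge_min lexx orbT.
exists c => //; split; apply/fmpP; split.
- move=> v; rewrite degD degZ; have := le2 v; rewrite ler_norml; lra.
- by move=> e; have := le1 e; rewrite !ffunE ler_norml /GRing.scale /=; lra.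
- move=> v; rewrite degD degN degZ; have := le2 v; rewrite ler_norml; lra.
- by move=> e; have := le1 e; rewrite !ffunE ler_norml /GRing.scale /=; lra.
Qed.

Lemma dotpD (c x y : vec) : dotp c (x + y) = dotp c x + dotp c y.
Proof. by rewrite /dotp -big_split; apply: eq_bigr => e _; rewrite ffunE mulrDr. Qed.

Lemma dotpZ (c : vec) (a : R) x : dotp c (a *: x) = a * dotp c x.
Proof. by rewrite /dotp mulr_sumr; apply: eq_bigr => e _; rewrite ffunE mulrCA. Qed.

Lemma dotpN (c x : vec) : dotp c (- x) = - dotp c x.
Proof. by rewrite -scaleN1r dotpZ mulN1r. Qed.

Lemma face_sub (F : set vec) x : is_face P F -> F x -> P x.
Proof. by move=> [c [b [_ ->]]] []. Qed.

(** A linear functional maximal at [x] can increase neither along [d] nor along [- d], so it is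
    constant on that line. *)
Lemma face_kernel (F : set vec) x d : is_face P F -> F x -> kernel x d ->
  exists2 c, 0 < c & F (x + c *: d).
Proof.
move=> [c [b [le ->]]] [px cx] k; have [e e0 [p1 p2]] := kernel_move px k.
exists e => //; split => //; apply/eqP; rewrite eq_le le //=.
have := le _ p2; rewrite !dotpD dotpN cx; lra.
Qed.

Lemma vertex_fmp x : is_vertex P x -> P x.
Proof. by move=> /face_sub; apply. Qed.

Lemma vertex_kernel x d : is_vertex P x -> kernel x d -> d = 0.
Proof.
move=> vx k; have [|c c0] := face_kernel vx _ k; first by [].
move=> /= /eqP; rewrite -subr_eq0 addrC addKr scaler_eq0 gt_eqF //= => /eqP //.
Qed.

Definition min_face x : set vec := [set z | [/\ P z,
  forall e, x e = 0 -> z e = 0 & forall v, deg x v = 1 -> deg z v = 1]]%classic.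

(** The exposing functional adds the node sums tight at [x] and subtracts the coordinates that
    vanish at [x]. Its gap to the bound is a sum of nonnegative slacks, which is zero only if every
    one of them is. *)
Lemma min_face_face x : is_face P (min_face x).
Proof.
pose c : vec := [ffun e : edge adj => \sum_(v | deg x v == 1) (v \in val e)%:R - (x e == 0)%:R].
exists c, (#|[pred v | deg x v == 1]|%:R).
have cE z : dotp c z = \sum_(v | deg x v == 1) deg z v - \sum_(e : edge adj | x e == 0) z e.
  rewrite /dotp; under eq_bigr => e _ do rewrite ffunE mulrBl mulr_suml.
  rewrite big_split /= exchange_big /= sumrN; congr (_ - _).
    apply: eq_bigr => v _; rewrite degE [RHS]big_mkcond /=; apply: eq_bigr => e _.
    by case: ifP; rewrite ?mul1r ?mul0r.
  rewrite [RHS]big_mkcond /=; apply: eq_bigr => e _.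
  by case: ifP; rewrite ?mul1r ?mul0r.
have kE : #|[pred v | deg x v == 1]|%:R = \sum_(v | deg x v == 1) (1 : R).
  by rewrite sumr_const.
have gap z : #|[pred v | deg x v == 1]|%:R - dotp c z =
    \sum_(v | deg x v == 1) (1 - deg z v) + \sum_(e : edge adj | x e == 0) z e.
  by rewrite cE kE big_split /= sumrN opprB addrCA addrA addrAC -addrA addrC; ring.
split => [z /fmpP [z0 z1]|].
  rewrite -subr_ge0 gap addr_ge0 // sumr_ge0 // => v _; by rewrite subr_ge0.
apply/seteqP; split => z /=.
  move=> [pz h1 h2]; split => //; apply/eqP; rewrite eq_sym -subr_eq0 gap.
  rewrite !big1 ?addr0 // => [e /eqP /h1 //|v /eqP /h2 ->]; by rewrite subrr.
move=> [pz /eqP]; rewrite eq_sym -subr_eq0 gap.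
have [z0 z1] := (fmpP z).1 pz.
have s1 : 0 <= \sum_(v | deg x v == 1) (1 - deg z v).
  by apply: sumr_ge0 => v _; rewrite subr_ge0.
have s2 : 0 <= \sum_(e : edge adj | x e == 0) z e by apply: sumr_ge0.
rewrite paddr_eq0 // => /andP [/eqP e1 /eqP e2]; split => //.
  move=> e /eqP xe; exact: (psumr_eq0P _ e2).
move=> v /eqP xv; apply/eqP; rewrite eq_sym -subr_eq0; apply/eqP.
by apply: (psumr_eq0P _ e1) => // w _; rewrite subr_ge0.
Qed.

Lemma min_face_diff x y z : min_face x y -> min_face x z -> kernel x (z - y).
Proof.
move=> [_ h1 h2] [_ h3 h4]; split => [e xe|v xv].
  by rewrite !ffunE h1 // h3 // subrr.
by rewrite degD degN h2 // h4 // subrr.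
Qed.

Lemma kernel_vertex x : P x -> (forall d, kernel x d -> d = 0) -> is_vertex P x.
Proof.
move=> px h; have := min_face_face x.
suff -> : min_face x = [set x]%classic by [].
apply/seteqP; split => z /=; last by move=> ->.
move=> mz; have mx : min_face x x by [].
by have /eqP := h _ (min_face_diff mx mz); rewrite subr_eq0 => /eqP.
Qed.

(** For points of [P], a constraint is tight at the midpoint only if it is tight at both, so
    [min_face (mid x y)] is the smallest face containing both. *)
Definition mid x y : vec := 2^-1 *: (x + y).

Lemma mid_fmp x y : P x -> P y -> P (mid x y).
Proof.
move=> /fmpP [x0 x1] /fmpP [y0 y1]; apply/fmpP; split => [v|e].
  by rewrite degZ degD; have := x0 v; have := y0 v; lra.
by rewrite !ffunE /GRing.scale /=; have := x1 e; have := y1 e; lra.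
Qed.

Lemma mid_zero x y e : P x -> P y -> mid x y e = 0 -> x e = 0 /\ y e = 0.
Proof.
move=> /fmpP [_ x1] /fmpP [_ y1]; rewrite !ffunE /GRing.scale /=.
have := x1 e; have := y1 e; set a := x e; set b := y e; clearbody a b; lra.
Qed.

Lemma mid_tight x y v : P x -> P y -> deg (mid x y) v = 1 -> deg x v = 1 /\ deg y v = 1.
Proof.
move=> /fmpP [x1 _] /fmpP [y1 _]; rewrite degZ degD.
have := x1 v; have := y1 v; lra.
Qed.

Lemma mid_min_face x y : P x -> P y -> min_face (mid x y) x /\ min_face (mid x y) y.
Proof.
move=> px py; split; split => //.
- by move=> e /(mid_zero px py) [].
- by move=> e /(mid_tight px py) [].
- by move=> e /(mid_zero px py) [].
- by move=> e /(mid_tight px py) [].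
Qed.

(** If the coordinate [e0] determines every kernel direction, the kernel is at most a line, so the
    smallest face containing [x] and [y] is an edge. *)
Lemma kernel_adj x y e0 : is_vertex P x -> is_vertex P y -> x <> y ->
  (forall d, kernel (mid x y) d -> d e0 = 0 -> d = 0) -> skel_adj P x y.
Proof.
move=> vx vy nxy h; split => //; exists (min_face (mid x y)).
have [mx my] := mid_min_face (vertex_fmp vx) (vertex_fmp vy).
split => //; first exact: min_face_face.
split.
  exists [:: x; y]; split => //.
    by move=> z; rewrite !inE => /orP [] /eqP ->.
  by rewrite /aff_indep /= seq1_free subr_eq0; apply/eqP => /esym.
case=> [|z0 [|z1 [|z2 l]]] // Hs /=; rewrite free_cons => /andP [].
have m0 : min_face (mid x y) z0 by apply: Hs; rewrite !inE eqxx.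
have m1 : min_face (mid x y) z1 by apply: Hs; rewrite !inE eqxx ?orbT.
have m2 : min_face (mid x y) z2 by apply: Hs; rewrite !inE eqxx ?orbT.
have [k1a k1b] := min_face_diff m0 m1; have [k2a k2b] := min_face_diff m0 m2.
set d1 := z1 - z0 in k1a k1b *; set d2 := z2 - z0 in k2a k2b *; clearbody d1 d2.
move=> /negP n1; rewrite free_cons => /andP [n2 _]; case: n1.
have d2n : d2 != 0 by apply: contraNneq n2 => ->; rewrite mem0v.
have d2e : d2 e0 != 0 by apply: contraNneq d2n => E; apply/eqP/h.
suff -> : d1 = (d1 e0 / d2 e0) *: d2.
  by apply: memvZ; apply: memv_span; rewrite inE eqxx.
apply/eqP; rewrite -subr_eq0; apply/eqP; apply: h.
  split => [e xe|v xv]; first by rewrite !ffunE (k1a e) // (k2a e) // scaler0 subr0.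
  by rewrite degD degN degZ k1b // k2b // mulr0 subr0.
by rewrite !ffunE /GRing.scale /= divfK // subrr.
Qed.

(** Otherwise the midpoint, [y] and a point reached from the midpoint along [d] are affinely
    independent in a 1-dimensional face: [y - mid x y] is nonzero at [e0], where [d] vanishes. *)
Lemma adj_kernel x y e0 d : skel_adj P x y -> x e0 <> y e0 ->
  kernel (mid x y) d -> d e0 = 0 -> d = 0.
Proof.
move=> [vx vy _ [F [fF [_ dimF] Fx Fy]]] ne k d0; apply: contrapT => /eqP dn.
have Fm : F (mid x y).
  have := mid_fmp (vertex_fmp vx) (vertex_fmp vy).
  move: fF Fx Fy => [c [b [_ ->]]] [_ cx] [_ cy] pm; split => //.
  by rewrite dotpZ dotpD cx cy; lra.
have [c c0 Fc] := face_kernel fF Fm k.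
suff : (3 <= 2)%N by [].
apply: (dimF [:: mid x y; y; mid x y + c *: d]).
  by move=> z; rewrite !inE => /or3P [] /eqP ->.
rewrite /aff_indep /= free_cons seq1_free (addrC (mid x y)) addrK scaler_eq0 gt_eqF //=.
rewrite dn andbT span_seq1; apply/negP => /vlineP [a E].
apply: ne; have := congr1 (fun f : vec => f e0) E.
rewrite !ffunE d0 /GRing.scale /= !mulr0.
set p := x e0; set q := y e0; clearbody p q; lra.
Qed.

Lemma skel_adj_sym x y : skel_adj P x y -> skel_adj P y x.
Proof.
by move=> [vx vy n [F [f1 f2 f3 f4]]]; split => // [E|]; [apply: n | exists F].
Qed.

End EdgeVectors.

(** * Steps of the polytope *)

Section Join.
Variables (V : finType) (adj : rel V).
Hypotheses (adj_sym : symmetric adj).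
Implicit Types (s t : {perm V}) (a b u v : V).

(** Both nodes are freed from their cycles and then matched to each other. It is meant for [b]
    outside the cycle of [a], so that the two exposures do not interfere. *)
Definition join s a b := link a b (expose (expose s a) b).

Lemma expose_eq_on s t a v : {in porbit s a, s =1 t} -> v \in porbit s a ->
  expose s a v = expose t a v.
Proof.
move=> st vP; have cl u : u \in porbit s a -> s u \in porbit s a by rewrite mem_porbit_step.
have Eo := porbit_eq_on cl st (porbit_id s a).
have Ei i : iter i s a = iter i t a.
  by elim: i => //= i <-; rewrite st ?iter_mem_porbit.
have [i lti ->] := porbit_iter vP.
by rewrite expose_iter // [in RHS]Ei expose_iter -?Eo // /mate_index -Eo Ei.
Qed.

Section Facts.
Variables (s : {perm V}) (a b : V).
Hypothesis nab : b \notin porbit s a.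

Lemma join_disj v : v \in porbit s a -> v \in porbit s b -> False.
Proof.
move=> va vb; move: nab; rewrite -(porbit_trans va) (porbit_trans vb).
by rewrite porbit_id.
Qed.

Lemma join_porbit : porbit (expose s a) b = porbit s b.
Proof.
apply/esym; apply: (porbit_eq_on (@porbitC_closed V s a) (@expose_eq_out V s a)).
by rewrite inE.
Qed.

Lemma join_neq : a != b.
Proof. by apply: contraNneq nab => ->; rewrite porbit_id. Qed.

Lemma joinL : join s a b a = b.
Proof. by rewrite linkL ?expose_self. Qed.

Lemma joinR : join s a b b = a.
Proof.
rewrite linkR // expose_out ?expose_self // join_porbit.
by apply/negP; apply: join_disj; rewrite porbit_id.
Qed.

Lemma join_inL v : v \in porbit s a -> v != a -> join s a b v = expose s a v.
Proof.
move=> va nva; rewrite linkD //; last by apply: contraNneq nab => <-.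
by rewrite expose_out // join_porbit; apply/negP; apply: join_disj.
Qed.

Lemma join_inR v : v \in porbit s b -> v != b -> join s a b v = expose s b v.
Proof.
move=> vb nvb; rewrite linkD //; last first.
  by apply/eqP => E; apply: (@join_disj v) => //; rewrite E porbit_id.
apply/esym; apply: expose_eq_on => // u ub; rewrite expose_out //.
by apply/negP => /join_disj; apply.
Qed.

Lemma join_out v : v \notin porbit s a -> v \notin porbit s b -> join s a b v = s v.
Proof.
move=> va vb; rewrite linkD; first by rewrite !expose_out ?join_porbit.
  by apply: contraNneq va => ->; rewrite porbit_id.
by apply: contraNneq vb => ->; rewrite porbit_id.
Qed.

Lemma join_neighbour v : v != a -> v != b ->
  [\/ join s a b v = v, join s a b v = s v | join s a b v = s^-1%g v].
Proof.
move=> na nb; case: (boolP (v \in porbit s a)) => va.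
  by rewrite join_inL //; apply: expose_neighbour.
case: (boolP (v \in porbit s b)) => vb; first by rewrite join_inR //; apply: expose_neighbour.
by rewrite join_out //; constructor 2.
Qed.

Lemma join_fixedL : expose (expose s a) b a = a.
Proof.
rewrite expose_out ?expose_self // join_porbit.
by apply/negP; apply: join_disj; rewrite porbit_id.
Qed.

Lemma conf_join : conf adj s -> adj a b -> conf adj (join s a b).
Proof.
move=> cs ab; apply: conf_link => //; first by do 2 apply: conf_expose => //.
  exact: join_fixedL.
exact: expose_self.
Qed.

Lemma score_join (R : realType) : conf adj s -> s (s a) != a -> s (s b) != b ->
  score R (join s a b) = score R s - 1.
Proof.
move=> cs ca cb; rewrite score_link ?join_neq ?expose_self ?join_fixedL //.
rewrite (@score_expose _ _ adj) ?conf_expose //; last first.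
  by rewrite -card_porbit_le2 join_porbit card_porbit_le2.
by rewrite (@score_expose _ _ adj) //; lra.
Qed.

End Facts.
End Join.

(** * Vectors of configurations and single steps between them *)

Section ConfVectors.
Variables (R : realType) (V : finType) (adj : rel V).
Hypotheses (adj_sym : symmetric adj) (adj_irr : irreflexive adj).
Notation vec := (vect R (edge adj)).
Notation P := (@frac_matching_polytope R V adj).
Implicit Types (s t : {perm V}) (u v w : V) (D : V -> V -> R).

(** General weights are allowed because, besides the constant 1/2 of [xv], alternating signs serve
    later to exclude even cycles of length at least 4. A fixed node contributes to no edge, since
    [[set v; v]] is not one. *)
Definition wv (g : V -> R) s : vec :=
  [ffun e : edge adj => \sum_(v | val e == [set v; s v]) g v].

(* Both nodes of a 2-cycle contribute 1/2 to the same edge. *)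
Definition xv s : vec := wv (fun=> 2^-1) s.

Lemma adj_neq u v : adj u v -> u != v.
Proof. by apply: contraTneq => ->; rewrite adj_irr. Qed.

Lemma ev_wv g s u v : adj u v ->
  ev (wv g s) u v = (s u == v)%:R * g u + (s v == u)%:R * g v.
Proof.
move=> uv; have [e E] := adj_edge adj_sym uv; rewrite (ev_edge _ E) ffunE E.
have nuv := adj_neq uv; have nvu : v != u by rewrite eq_sym.
rewrite big_mkcond (bigD1 u) // (bigD1 v) //= big1 ?addr0 => [|w /andP [wu wv]].
  congr (_ + _).
    have -> : ([set u; v] == [set u; s u]) = (s u == v).
      apply/eqP/eqP => [/set2_eq [] [e1 e2]|->] //.
      by move: nuv; rewrite e2 eqxx.
    by case: eqP; rewrite ?mul1r ?mul0r.
  have -> : ([set u; v] == [set v; s v]) = (s v == u).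
    apply/eqP/eqP => [/set2_eq [] [e1 e2]|->] //; last by rewrite setUC.
    by move: nuv; rewrite e1 eqxx.
  by case: eqP; rewrite ?mul1r ?mul0r.
case: eqP => // /set2_eq [] [e1 e2]; first by rewrite e1 eqxx in wu.
by rewrite e2 eqxx in wv.
Qed.

Lemma ev_xv_adj s u v : adj u v ->
  ev (xv s) u v = ((s u == v)%:R + (s v == u)%:R) / 2.
Proof. by move=> uv; rewrite ev_wv // mulrDl. Qed.

(** The part of [conf] that holds for the permutation supplied by Hall's theorem, before its even
    cycles of length at least 4 are excluded. *)
Definition graphic s := forall v, s v != v -> adj v (s v).

Lemma deg_wv g s v : graphic s -> deg (wv g s) v = (s v != v)%:R * (g v + g (s^-1%g v)).
Proof.
move=> gs; have E u : ev (wv g s) v u =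
    (if u == s v then (s v != v)%:R * g v else 0) +
    (if u == s^-1%g v then (s v != v)%:R * g (s^-1%g v) else 0).
  have [->|nu] := eqVneq u v.
    rewrite ev_diag // -[v == s^-1%g v](inj_eq (@perm_inj _ s)) permKV [v == s v]eq_sym.
    by case: eqP; rewrite ?mul0r ?addr0.
  have [av|nav] := boolP (adj v u).
    rewrite ev_wv // [s v == u]eq_sym -[u == s^-1%g v](inj_eq (@perm_inj _ s)) permKV.
    congr (_ + _); case: eqP => h; rewrite ?mul0r //; last first.
      have -> : s v != v by apply: contraNneq nu => E; apply/eqP/(@perm_inj _ s); rewrite h E.
      by rewrite -h permK.
    by rewrite -h nu.
  rewrite ev_nadj //; case: eqP => [E1|_].
    by case/negP: nav; rewrite E1; apply: gs; rewrite -E1.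
  rewrite add0r; case: eqP => [E1|_] //.
  case/negP: nav; rewrite adj_sym -[X in adj _ X](permKV s) -E1; apply: gs.
  by rewrite E1 permKV -E1 eq_sym.
rewrite /deg (eq_bigr _ (fun u _ => E u)) big_split /= -!big_mkcond /= !big_pred1_eq.
by rewrite mulrDr.
Qed.

Lemma conf_graphic s : conf adj s -> graphic s.
Proof. by move=> cs v; apply: conf_adj. Qed.

Lemma deg_xv_graphic s v : graphic s -> deg (xv s) v = (s v != v)%:R.
Proof.
move=> gs; rewrite deg_wv // -[X in _ * (X + _)]mul1r -[X in _ * (_ + X)]mul1r.
by rewrite -mulrDl divff ?mulr1 // (_ : 1 + 1 = 2%:R) ?pnatr_eq0.
Qed.

Lemma deg_xv s v : conf adj s -> deg (xv s) v = (s v != v)%:R.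
Proof. by move=> /conf_graphic; apply: deg_xv_graphic. Qed.

Lemma xv_ge0 s e : 0 <= xv s e.
Proof. by rewrite ffunE sumr_ge0 // => v _; rewrite invr_ge0 ler0n. Qed.

Lemma fmp_xv s : conf adj s -> P (xv s).
Proof.
move=> cs; apply/(fmpP adj_irr); split => [v|e]; last exact: xv_ge0.
by rewrite deg_xv //; case: (_ != _); rewrite ?ler01.
Qed.

(* [D] is the symmetric matrix of an element of the kernel of the face spanned
   by the vertices of [s] and [t]. *)
Definition kernel_mx s t D :=
  [/\ forall u v, D u v = D v u, forall v, D v v = 0,
      forall u v, D u v != 0 -> [\/ s u = v, s v = u, t u = v | t v = u] &
      forall v, s v != v -> t v != v -> \sum_u D v u = 0].

Lemma kernel_mxP s t d : conf adj s -> conf adj t ->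
  kernel (mid (xv s) (xv t)) d -> kernel_mx s t (ev d).
Proof.
move=> cs ct [k1 k2]; split.
- by move=> u v; apply: ev_sym.
- by move=> v; apply: ev_diag.
- move=> u v n; have uv : adj u v by apply: contraNT n => /ev_nadj ->.
  have [e E] := adj_edge adj_sym uv; move: n; rewrite (ev_edge _ E) => n.
  have : mid (xv s) (xv t) e != 0 by apply: contraNneq n => /k1 ->.
  rewrite -(ev_edge _ E) evZ evD !ev_xv_adj //.
  case: (s u =P v) => [|_]; first by constructor 1.
  case: (s v =P u) => [|_]; first by constructor 2.
  case: (t u =P v) => [|_]; first by constructor 3.
  case: (t v =P u) => [|_]; first by constructor 4.
  by rewrite !(addr0, mul0r, mulr0) eqxx.
move=> v sv tv; apply: k2; rewrite degZ degD !deg_xv // sv tv /=; lra.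
Qed.

Section Neighbours.
Variables (s : {perm V}) (D : V -> V -> R).
Hypotheses (Dsym : forall u v, D u v = D v u) (Ddiag : forall v, D v v = 0).

Let near w := forall v, D w v != 0 -> v = s w \/ v = s^-1%g w.

Lemma near_fixed w : s w = w -> near w -> forall v, D w v = 0.
Proof.
move=> fw nw v; apply/eqP; apply: contraT => n.
have E : s^-1%g w = w by rewrite -{1}fw permK.
by move: (n); case: (nw _ n) => ->; rewrite ?fw ?E Ddiag eqxx.
Qed.

Lemma near_pair w : s (s w) = w -> near w -> \sum_u D w u = D w (s w).
Proof.
move=> fw nw; rewrite (bigD1 (s w)) //= big1 ?addr0 // => u nu.
apply/eqP; apply: contraT => n; have E : s^-1%g w = s w by rewrite -{1}fw permK.
by move: nu; case: (nw _ n) => ->; rewrite ?E eqxx.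
Qed.

Lemma near_cycle w : s (s w) != w -> near w ->
  \sum_u D w u = D w (s w) + D w (s^-1%g w).
Proof.
move=> fw nw; have n : s^-1%g w != s w.
  by apply: contraNneq fw => <-; rewrite permKV.
rewrite (bigD1 (s w)) // (bigD1 (s^-1%g w)) //= big1 ?addr0 // => u /andP [nu nu'].
by apply/eqP; apply: contraT => m; move: nu nu'; case: (nw _ m) => ->; rewrite eqxx.
Qed.

(** On a long cycle zero row sums make consecutive entries alternate in sign, so odd length forces
    them to vanish. On a 2-cycle the only entry is itself a row sum, so the condition at [a]
    suffices. The row of a fixed node reduces to its diagonal entry. *)
Lemma near_orbit_eq0 a : conf adj s -> (forall w, w \in porbit s a -> near w) ->
  (s a != a -> \sum_u D a u = 0) ->
  (s (s a) != a -> forall w, w \in porbit s a -> \sum_u D w u = 0) ->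
  forall w v, w \in porbit s a -> D w v = 0.
Proof.
move=> cs nr s1 s2 w v wa; have [fa|na] := eqVneq (s a) a.
  apply: near_fixed (nr _ wa) _; apply/eqP; by rewrite (sfix_porbit wa) fa.
have [pa|ca] := eqVneq (s (s a)) a.
  have D0 : D a (s a) = 0 by rewrite -near_pair ?s1 //; apply: nr; rewrite porbit_id.
  have E : s^-1%g a = s a by rewrite -{1}pa permK.
  apply/eqP; apply: contraT => n; move: (n); have := nr _ wa _ n.
  move: wa; rewrite (porbit_pair pa) !inE => /pred2P [->|->].
    by rewrite E => -[] ->; rewrite D0 eqxx.
  by rewrite pa permK => -[] ->; rewrite Dsym D0 eqxx.
have g0 u : u \in porbit s a -> D u (s u) = 0.
  move=> ua; apply: (@odd_alternate_eq0 _ _ s _ (fun u => D u (s u))).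
    by rewrite (porbit_trans ua) (conf_odd cs).
  move=> z zu; have za : z \in porbit s a by rewrite -(porbit_trans ua).
  have sza : s z \in porbit s a by rewrite mem_porbit_step.
  have := s2 ca _ sza; rewrite near_cycle ?permK; last exact: nr.
    by move=> /eqP; rewrite addr_eq0 => /eqP ->; rewrite Dsym.
  by rewrite (sinv_porbit sza).
apply/eqP; apply: contraT => n; move: (n); case: (nr _ wa _ n) => ->.
  by rewrite g0 ?eqxx.
have pa : s^-1%g w \in porbit s a by rewrite mem_porbit_inv.
by have := g0 _ pa; rewrite permKV Dsym => ->; rewrite eqxx.
Qed.

End Neighbours.

Lemma conf_vertex s : conf adj s -> is_vertex P (xv s).
Proof.
move=> cs; apply: (kernel_vertex adj_irr); first exact: fmp_xv.
move=> d kd; have km : kernel (mid (xv s) (xv s)) d.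
  suff -> : mid (xv s) (xv s) = xv s by [].
  by apply/ffunP => e; rewrite !ffunE /GRing.scale /=; lra.
have [Ds Dd Dn D0] := kernel_mxP cs cs km.
apply: eq_ev => u v uv; rewrite [RHS]big1 => [|e _]; last by rewrite ffunE.
apply: (near_orbit_eq0 Ds Dd cs (a := u)) => [w _ z|n|n w wu|]; last exact: porbit_id.
- by move=> /Dn [] <-; rewrite ?permK; auto.
- exact: D0.
by apply: D0; rewrite (sfix_porbit wu); apply: contraNneq n => E; rewrite !E.
Qed.

Lemma conf_skel_adj s t a b : conf adj s -> conf adj t -> adj a b ->
  ev (xv s) a b <> ev (xv t) a b ->
  (forall D, kernel_mx s t D -> D a b = 0 -> forall u v, D u v = 0) ->
  skel_adj P (xv s) (xv t).
Proof.
move=> cs ct ab ne h; have [e E] := adj_edge adj_sym ab.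
apply: (kernel_adj adj_irr (e0 := e)); try exact: conf_vertex.
  by move=> eq; apply: ne; rewrite eq.
move=> d kd de; apply: eq_ev => u v uv.
rewrite [RHS]big1 => [|f _]; last by rewrite ffunE.
by apply: h; [exact: kernel_mxP | rewrite (ev_edge _ E)].
Qed.

(** Setting the entry of the edge [a b] to zero leaves only edges of [s]. The nodes of long cycles
    stay covered, and a broken 2-cycle keeps [a] or [b] covered, so the remaining entries vanish
    orbit by orbit. *)
Lemma skel_adj_join s a b : conf adj s -> adj a b -> b \notin porbit s a ->
  skel_adj P (xv s) (xv (join s a b)).
Proof.
move=> cs ab nab; have cj := conf_join adj_sym nab cs ab.
have nba : a \notin porbit s b by rewrite porbit_sym.
apply: (@conf_skel_adj _ _ a b) => //.
  rewrite !ev_xv_adj // joinL joinR // !eqxx.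
  have -> : (s a == b) = false by apply: contraNF nab => /eqP <-; rewrite mem_porbit1.
  have -> : (s b == a) = false by apply: contraNF nba => /eqP <-; rewrite mem_porbit1.
  by move=> /=; lra.
move=> D [Ds Dd Dn D0] Dab.
have Dba : D b a = 0 by rewrite Ds.
have nr w v : D w v != 0 -> v = s w \/ v = s^-1%g w.
  move=> n; have nwv : w != v by apply: contraNneq n => ->; rewrite Dd.
  have nvw : v != w by rewrite eq_sym.
  have key x y : x != y -> D x y != 0 -> join s a b x = y -> y = s x \/ y = s^-1%g x.
    move=> nxy m E; have xa : x != a.
      by apply: contraNneq m => xa; rewrite -E xa joinL // Dab.
    have xb : x != b by apply: contraNneq m => xb; rewrite -E xb joinR // Dba.
    case: (join_neighbour nab xa xb); rewrite E; auto.
    by move=> F; rewrite F eqxx in nxy.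
  case: (Dn _ _ n) => [<-|<-|/(key _ _ nwv n)|E]; rewrite ?permK; auto.
  by case: (key _ _ nvw _ E) => [|->|->]; rewrite ?permK ?permKV -1?Ds; auto.
have nja : join s a b a != a by rewrite joinL // eq_sym (join_neq nab).
have njb : join s a b b != b by rewrite joinR // (join_neq nab).
have fixn x w : s (s x) != x -> w \in porbit s x -> s w != w.
  by move=> n wx; rewrite (sfix_porbit wx); apply: contraNneq n => E; rewrite !E.
move=> u v; case: (boolP (u \in porbit s a)) => ua.
  apply: (near_orbit_eq0 Ds Dd cs _ _ _ v ua) => [w _|n|n w wa]; first exact: nr.
    exact: D0.
  apply: D0; first exact: fixn wa.
  have [->|wna] := eqVneq w a; first exact: nja.
  rewrite join_inL //; apply: contraNneq wna => /expose_fixed -> //.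
  exact: conf_odd cs n.
case: (boolP (u \in porbit s b)) => ub.
  apply: (near_orbit_eq0 Ds Dd cs _ _ _ v ub) => [w _|n|n w wb]; first exact: nr.
    exact: D0.
  apply: D0; first exact: fixn wb.
  have [->|wnb] := eqVneq w b; first exact: njb.
  rewrite join_inR //; apply: contraNneq wnb => /expose_fixed -> //.
  exact: conf_odd cs n.
apply: (near_orbit_eq0 Ds Dd cs _ _ _ v (porbit_id s u)) => [w _|n|n w wu]; first exact: nr.
  by apply: D0; rewrite ?join_out.
have := fixn _ _ n wu => nw; apply: D0 => //.
rewrite join_out //; [move: ua | move: ub]; rewrite porbit_sym -(porbit_trans wu) porbit_sym //.
Qed.

(** The new vertex exposes [a], so row sums on the cycle are known to vanish only at the other
    nodes. These suffice to carry the zero entry at the edge from [a] to [s a] all around the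
    cycle. *)
Lemma skel_adj_expose s a : conf adj s -> s (s a) != a ->
  skel_adj P (xv s) (xv (expose s a)).
Proof.
move=> cs ca; have ce := conf_expose adj_sym a cs.
have na : s a != a by apply: contraNneq ca => E; rewrite !E.
have on := conf_odd cs ca.
apply: (@conf_skel_adj _ _ a (s a)) => //; first exact: conf_adj.
  rewrite !ev_xv_adj ?conf_adj // eqxx expose_self expose_next // (negbTE ca) eq_sym (negbTE na).
  by move=> /=; lra.
move=> D [Ds Dd Dn D0] Dab.
have nr w v : D w v != 0 -> v = s w \/ v = s^-1%g w.
  move=> n; have nwv : w != v by apply: contraNneq n => ->; rewrite Dd.
  case: (Dn _ _ n) => E; rewrite -?E ?permK; auto.
    case: (expose_neighbour s a w); rewrite E; auto.
    by move=> F; rewrite F eqxx in nwv.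
  case: (expose_neighbour s a v); rewrite E; auto => F; last by rewrite F permKV; auto.
    by rewrite F eqxx in nwv.
  by rewrite F permK; auto.
have g0 i : D (iter i s a) (s (iter i s a)) = 0.
  elim: i => [|i IH] //; rewrite iterS; set u := iter i s a in IH *.
  have ua : s u \in porbit s a by rewrite mem_porbit_step iter_mem_porbit.
  have [->|nu] := eqVneq (s u) a; first exact: Dab.
  have := D0 (s u); rewrite (@near_cycle s); last first.
  - by move=> v; apply: nr.
  - by rewrite (sinv_porbit ua).
  rewrite permK (Ds (s u) u) IH addr0; apply; first by rewrite (sfix_porbit ua).
  by apply: contraNneq nu => E; apply/eqP; apply: expose_fixed E.
move=> u v; case: (boolP (u \in porbit s a)) => ua.
  have [i _ Ei] := porbit_iter ua.
  apply/eqP; apply: contraT => n; move: (n); case: (nr _ _ n) => ->; first by rewrite Ei g0 eqxx.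
  have : s^-1%g u \in porbit s a by rewrite mem_porbit_inv.
  by move=> /porbit_iter [j _ Ej]; rewrite Ds -[u in D _ u](permKV s) Ej g0 eqxx.
apply: (near_orbit_eq0 Ds Dd cs _ _ _ v (porbit_id s u)) => [w _|n|n w wu]; first exact: nr.
  by apply: D0; rewrite ?expose_out.
have nw : s w != w by rewrite (sfix_porbit wu); apply: contraNneq n => E; rewrite !E.
apply: D0 => //; rewrite expose_out //.
by move: ua; rewrite porbit_sym -(porbit_trans wu) porbit_sym.
Qed.

End ConfVectors.

Section Neighbourhoods.
Variable V : finType.
Implicit Types s t : {perm V}.

Definition near s t v := [\/ s v = v, s v = t v | s v = t^-1%g v].

(** If [s2] follows [s1] backwards at [v], it retraces the [s1]-step out of [s1^-1%g v], so
    closeness to [s] is also needed at that node. *)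
Lemma near_trans s s1 s2 v :
  near s2 s1 v -> near s1 s v -> near s1 s (s1^-1%g v) -> near s2 s v.
Proof.
move=> [E|E|E] n1 n2; first by constructor 1.
  by case: n1 => F; rewrite /near E F; [constructor 1 | constructor 2 | constructor 3].
rewrite /near E; move: n2; set u := s1^-1%g v; rewrite /near permKV => -[] F.
- by constructor 1.
- by constructor 3; rewrite F permK.
- by constructor 2; rewrite F permKV.
Qed.

Lemma join_involutive s a b v : b \notin porbit s a ->
  s (s v) = v \/ v \in porbit s a :|: porbit s b ->
  join s a b (join s a b v) = v.
Proof.
move=> nab; case: (boolP (v \in porbit s a :|: porbit s b)).
  rewrite inE => h _.
  have [->|va] := eqVneq v a; first by rewrite joinL // joinR.
  have [->|vb] := eqVneq v b; first by rewrite joinR // joinL.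
  case/orP: h => h.
    rewrite join_inL // join_inL ?mem_expose ?exposeK //.
    by rewrite -{2}(expose_self s a) (inj_eq perm_inj).
  rewrite join_inR // join_inR ?mem_expose ?exposeK //.
  by rewrite -{2}(expose_self s b) (inj_eq perm_inj).
rewrite inE negb_or => /andP [va vb] [E|//].
by rewrite !join_out ?mem_porbit_step.
Qed.

End Neighbourhoods.

(** * Walks between configurations, and the exchange of one edge for two *)

Section Walks.
Variables (R : realType) (V : finType) (adj : rel V).
Hypotheses (adj_sym : symmetric adj) (adj_irr : irreflexive adj).
Notation P := (@frac_matching_polytope R V adj).
Notation conf := (conf adj).
Notation xv := (@xv R V adj).
Implicit Types (s t : {perm V}) (A B W : {set V}).

Definition reach n s t := exists2 k, (k <= n)%N & skel_walk P (xv s) (xv t) k.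

Lemma reach_refl s : reach 0 s s.
Proof. by exists 0%N => //; exists [::]. Qed.

Lemma reach1 s t : skel_adj P (xv s) (xv t) -> reach 1 s t.
Proof. by move=> h; exists 1%N => //; exists [:: xv t]; split => //=; rewrite andbT; apply/asboolP. Qed.

Lemma reach_trans m n s1 s2 s3 : reach m s1 s2 -> reach n s2 s3 -> reach (m + n) s1 s3.
Proof.
move=> [k km [p [pp lp sp]]] [l ln [q [pq lq sq]]]; exists (k + l)%N; first exact: leq_add.
exists (p ++ q); rewrite cat_path last_cat lp pp pq lq size_cat sp sq; split => //.
Qed.

Lemma reach_le m n s t : (m <= n)%N -> reach m s t -> reach n s t.
Proof. by move=> mn [k km h]; exists k => //; apply: leq_trans mn. Qed.

Lemma reach_sym n s t : reach n s t -> reach n t s.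
Proof.
move=> [k kn [p [pp lp sp]]]; exists k => //; exists (rev (belast (xv s) p)).
split; last by rewrite size_rev size_belast.
  rewrite -lp -(@eq_path _ (fun y x => `[< skel_adj P x y >])) ?rev_path //.
  by move=> x y /=; apply/asboolP/asboolP; apply: skel_adj_sym.
case: p pp lp {sp} => [|y p] //= _ _.
by rewrite rev_cons last_rcons.
Qed.

Section DoubleJoin.
Variables (s : {perm V}) (a b a' b' : V).
Hypotheses (cs : conf s) (sa : s a = b) (sb : s b = a) (nab : a != b).
Hypotheses (adja : adj a a') (adjb : adj b b').
Hypotheses (na'b : a' != b) (nb'a : b' != a) (na'b' : a' != b').
Hypotheses (sa' : s (s a') = a') (sb' : s (s b') = b').

Let s1 := join s a a'.
Let s2 := join s1 b b'.

Let na'a : a' != a. Proof. by rewrite eq_sym (adj_neq adj_irr). Qed.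
Let nb'b : b' != b. Proof. by rewrite eq_sym (adj_neq adj_irr). Qed.

Let poa : porbit s a = [set a; b].
Proof. by rewrite porbit_pair sa. Qed.

Let na' : a' \notin porbit s a.
Proof. by rewrite poa !inE negb_or na'a. Qed.

Let s1b : s1 b = b.
Proof.
have bP : b \in porbit s a by rewrite poa !inE eqxx orbT.
by rewrite /s1 join_inL ?expose_small ?sa // eq_sym.
Qed.

Let s1b' : s1 (s1 b') = b'.
Proof. by apply: join_involutive => //; left. Qed.

Let pob : porbit s1 b = [set b].
Proof. by rewrite porbit_pair s1b // setUid. Qed.

Let nb' : b' \notin porbit s1 b.
Proof. by rewrite pob inE. Qed.

Let pob' : porbit s1 b' = [set b'; s1 b'].
Proof. exact: porbit_pair. Qed.

Let s1a : s1 a = a'. Proof. exact: joinL. Qed.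
Let s1a' : s1 a' = a. Proof. exact: joinR. Qed.

Lemma join2_conf : conf s2.
Proof. by apply: conf_join => //; apply: conf_join. Qed.

Lemma join2_b : s2 b = b'. Proof. exact: joinL. Qed.
Lemma join2_b' : s2 b' = b. Proof. exact: joinR. Qed.

Lemma join2_a : s2 a = a'.
Proof.
rewrite /s2 join_out // ?pob ?pob' !inE // negb_or eq_sym nb'a /=.
by rewrite -s1a' (inj_eq perm_inj).
Qed.

Lemma join2_a' : s2 a' = a.
Proof.
rewrite /s2 join_out // ?pob ?pob' !inE // negb_or na'b' /=.
by rewrite -s1a (inj_eq perm_inj) eq_sym.
Qed.

Lemma join2_near v : v != a -> v != b -> v != a' -> v != b' -> near s2 s v.
Proof.
move=> va vb va' vb'; apply: (@near_trans _ s s1); try by apply: join_neighbour.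
apply: join_neighbour => //.
  by rewrite -(inj_eq (@perm_inj _ s1)) permKV s1a.
by rewrite -(inj_eq (@perm_inj _ s1)) permKV s1a'.
Qed.

Lemma join2_out v : v \notin porbit s a -> v \notin porbit s a' ->
  v \notin porbit s b' -> s2 v = s v.
Proof.
move=> va va' vb'.
have E : s1 v = s v by apply: join_out.
have nv : v != b by apply: contraNneq va => ->; rewrite poa !inE eqxx orbT.
have nv' : v != b' by apply: contraNneq vb' => ->; rewrite porbit_id.
rewrite /s2 join_out // ?pob ?pob' !inE // negb_or nv' /=.
apply: contraNneq vb' => F.
have : s1 v = b' by rewrite F s1b'.
by rewrite E => <-; rewrite porbit_step porbit_id.
Qed.

Lemma join2_involutive v : s (s v) = v -> s2 (s2 v) = v.
Proof. by move=> E; do 2![apply: join_involutive => //; left]. Qed.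

(* The exchange of the edge [a b] for the two edges [a a'] and [b b'] is a single
   step of the polytope. *)
Lemma skel_adj_join2 : skel_adj P (xv s) (xv s2).
Proof.
have cs2 := join2_conf.
have adjab : adj a b by rewrite -sa conf_adj // sa eq_sym.
apply: (@conf_skel_adj _ _ _ adj_sym adj_irr _ _ a b) => //.
  rewrite !ev_xv_adj // sa sb join2_a join2_b !eqxx (negbTE na'b) (negbTE nb'a) /=; lra.
move=> D [Ds Dd Dn D0] Dab.
have Dba : D b a = 0 by rewrite Ds.
pose pair (x y : V) := [\/ (x, y) = (a, a'), (x, y) = (a', a), (x, y) = (b, b') | (x, y) = (b', b)].
have nr0 w v : D w v != 0 -> [\/ v = s w, v = s^-1%g w | pair w v].
  move=> n; have nwv : w != v by apply: contraNneq n => ->; rewrite Dd.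
  have key x y : x != y -> s2 x = y -> [\/ y = s x, y = s^-1%g x | pair x y].
    move=> nxy E.
    have [xa|xa] := eqVneq x a; first by constructor 3; rewrite -E xa join2_a; constructor 1.
    have [xb|xb] := eqVneq x b; first by constructor 3; rewrite -E xb join2_b; constructor 3.
    have [xa'|xa'] := eqVneq x a'; first by constructor 3; rewrite -E xa' join2_a'; constructor 2.
    have [xb'|xb'] := eqVneq x b'; first by constructor 3; rewrite -E xb' join2_b'; constructor 4.
    case: (join2_near xa xb xa' xb'); rewrite E => F; first by rewrite F eqxx in nxy.
      by constructor 1.
    by constructor 2.
  case: (Dn _ _ n) => [<-|<-|E|E].
  - by constructor 1.
  - by constructor 2; rewrite permK.
  - exact: key.
  rewrite eq_sym in nwv; case: (key _ _ nwv E) => [->|->|pr].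
  - by constructor 2; rewrite permK.
  - by constructor 1; rewrite permKV.
  - by constructor 3; case: pr => -[-> ->]; [constructor 2|constructor 1|constructor 4|constructor 3].
have two x y z : (forall v, D x v != 0 -> v = y \/ v = z) -> D x y = 0 -> \sum_u D x u = 0 -> D x z = 0.
  move=> h Dy; have [<- //|nyz] := eqVneq y z.
  rewrite (bigD1 z) //= big1 ?addr0 // => u nu; apply/eqP; apply: contraT => n.
  by move: (n) nu; case: (h _ n) => ->; rewrite ?Dy eqxx.
have Va : s^-1%g a = b by rewrite -sb permK.
have Vb : s^-1%g b = a by rewrite -sa permK.
(* The row of [a] has entries only at [b] and [a']. The first is zero, so the zero row sum kills the
   second; the row of [b] is treated alike. *)
have Daa' : D a a' = 0.
  apply: (two a b a') => // [v /nr0 [->|->|pr]|].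
  - by left.
  - by left.
  - by case: pr => [[->]|[E ->]|[E ->]|[E ->]]; [right | move: na'a | move: nab | move: nb'a]; rewrite // E eqxx.
  by apply: D0; rewrite ?join2_a ?sa // eq_sym.
have Dbb' : D b b' = 0.
  apply: (two b a b') => // [v /nr0 [->|->|pr]|].
  - by left.
  - by left.
  - by case: pr => [[E ->]|[E ->]|[->]|[E ->]]; [move: nab | move: na'b | right | move: nb'b]; rewrite // E eqxx.
  by apply: D0; rewrite ?join2_b ?sb.
have nr w v : D w v != 0 -> v = s w \/ v = s^-1%g w.
  move=> n; case: (nr0 _ _ n) => [->|->|pr]; auto.
  by case: pr => -[E F]; move: n; rewrite E F ?Daa' ?Dbb' 1?Ds ?Daa' ?Dbb' ?eqxx.
have small x u v : s (s x) = x -> s2 x != x -> u \in porbit s x -> D u v = 0.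
  move=> sx s2x ux; apply: (near_orbit_eq0 Ds Dd cs _ _ _ v ux) => [w _|n|]; first exact: nr.
    exact: D0.
  by rewrite sx eqxx.
move=> u v.
case: (boolP (u \in porbit s a)) => [|ua].
  by apply: small; rewrite ?sa ?join2_a.
case: (boolP (u \in porbit s a')) => [|ua'].
  by apply: small; rewrite ?join2_a' // eq_sym.
case: (boolP (u \in porbit s b')) => [|ub'].
  by apply: small; rewrite ?join2_b' // eq_sym.
apply: (near_orbit_eq0 Ds Dd cs _ _ _ v (porbit_id s u)) => [w _|n|n w wu]; first exact: nr.
  by apply: D0; rewrite ?join2_out.
have nw : s w != w by rewrite (sfix_porbit wu); apply: contraNneq n => E; rewrite !E.
have out x : u \notin porbit s x -> w \notin porbit s x.
  by apply: contra => wx; rewrite -(porbit_trans wx) porbit_sym.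
by apply: D0 => //; rewrite join2_out // out.
Qed.

End DoubleJoin.
End Walks.

(** * The upper bound *)

Section Absorb.
Variables (R : realType) (V : finType) (adj : rel V).
Hypotheses (adj_sym : symmetric adj) (adj_irr : irreflexive adj).
Notation P := (@frac_matching_polytope R V adj).
Notation conf := (conf adj).
Notation xv := (@xv R V adj).
Notation reach := (@reach R V adj).
Implicit Types (s : {perm V}) (A B W : {set V}).

Variable t : {perm V}.

(* Every cycle of [s] meeting [A] can be broken while an edge of the matching
   [t] on [A] is gained: either such an edge leaves the cycle, or two
   consecutive nodes of the cycle lie in [A]. *)
Definition breakable s A := forall v, v \in A -> s (s v) != v ->
  (exists g, [/\ g \in porbit s v, g \in A & t g \notin porbit s v]) \/
  (exists g, [/\ g \in porbit s v, g \in A & s g \in A]).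

Definition matching_on A := forall v, v \in A ->
  [/\ t v \in A, t v != v, t (t v) = v & adj v (t v)].

Lemma breakable_sub s s1 A B : breakable s A ->
  (forall v, v \in A -> v \notin B -> s1 (s1 v) != v ->
     [disjoint porbit s v & B] /\ {in porbit s v, s1 =1 s}) ->
  breakable s1 (A :\: B).
Proof.
move=> br h v; rewrite inE => /andP [vB vA] c1; have [dB eqs] := h v vA vB c1.
have Eo : porbit s1 v = porbit s v.
  apply/esym; apply: (porbit_eq_on (@porbit_closed V s v)) => [u uv|]; last exact: porbit_id.
  by rewrite eqs.
have cs : s (s v) != v by have := c1; rewrite (eqs v) ?porbit_id // eqs ?mem_porbit1.
have nB u : u \in porbit s v -> u \notin B by move=> uv; rewrite (disjointFr dB uv).
case: (br v vA cs) => -[g [gv gA hg]]; [left | right]; exists g; rewrite Eo !inE.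
  by rewrite (nB g gv) gA.
by rewrite eqs // hg (nB g gv) (nB (s g)) ?mem_porbit_step // gA.
Qed.

(** The last two conditions limit the effect off [A]: a node becomes fixed or goes to an old
    neighbour, and cycles avoiding [A] are untouched. They make stages composable and keep the
    changes inside [W] later on. *)
Definition absorbed n s A s' :=
  [/\ conf s', reach n s s', {in A, s' =1 t}, forall v, v \notin A -> near s' s v &
      forall v, [disjoint porbit s v & A] -> s' v = s v].

Lemma absorbed_trans m n s s1 s' A B : B \subset A ->
  (forall v, v \in B -> t v \in B) ->
  absorbed m s B s1 ->
  (forall v, [disjoint porbit s v & A] -> s1 v = s v) ->
  absorbed n s1 (A :\: B) s' -> absorbed (m + n) s A s'.
Proof.
move=> sBA clB [c1 r1 e1 n1 _] d1 [c' r' e' n' d'].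
have cl1 u : u \in B -> s1 u \in B by move=> uB; rewrite e1 // clB.
split => //.
- exact: reach_trans r1 r'.
- move=> v vA; case: (boolP (v \in B)) => vB; last by rewrite e' // inE vB.
  rewrite d' ?e1 //; rewrite disjoint_subset; apply/subsetP => u.
  by move=> /(subsetP (porbit_sub cl1 vB)) uB; rewrite !inE uB.
- move=> v vA; have vB : v \notin B by apply: contra vA; apply: (subsetP sBA).
  apply: (@near_trans _ s s1).
  + by apply: n'; rewrite inE (negbTE vA) andbF.
  + exact: n1.
  + apply: n1; apply: contra vB; by rewrite (mem_closed_inv _ cl1).
- move=> v dv.
  have eqs u : u \in porbit s v -> s1 u = s u by move=> uv; rewrite d1 // (porbit_trans uv).
  rewrite d' ?d1 //.
  have <- : porbit s v = porbit s1 v.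
    apply: (porbit_eq_on (@porbit_closed V s v)) => [u uv|]; last exact: porbit_id.
    by rewrite eqs.
  by apply: disjointWr dv; rewrite subsetDl.
Qed.

Lemma disjoint_notin s v A x : x \in A -> [disjoint porbit s v & A] -> v \notin porbit s x.
Proof. by move=> xA d; rewrite porbit_sym (disjointFl d xA). Qed.

Lemma absorbed_join s g : conf s -> adj g (t g) -> t (t g) = g -> t g \notin porbit s g ->
  absorbed 1 s [set g; t g] (join s g (t g)).
Proof.
move=> cs ag tg nP; split.
- exact: conf_join.
- by apply: reach1; apply: skel_adj_join.
- by move=> v; rewrite !inE => /pred2P [->|->]; rewrite ?joinL // joinR.
- by move=> v; rewrite !inE negb_or => /andP [va vb]; apply: join_neighbour.
- move=> v d; rewrite join_out //; apply: (disjoint_notin _ d); by rewrite !inE eqxx ?orbT.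
Qed.

(** At most one step is spent per matching edge on [A]. The induction removes from [A] a union [B]
    of matching edges, gained in at most [#|B| / 2] steps. *)
Lemma absorb_matching n A s : (#|A| <= n)%N -> conf s -> matching_on A -> breakable s A ->
  exists s', absorbed #|A|./2 s A s'.
Proof.
elim: n A s => [|n IH] A s cA cs mA brA.
  move: cA; rewrite leqn0 cards_eq0 => /eqP A0; exists s; rewrite A0 cards0.
  split => // [|v|v]; first exact: reach_refl; first by rewrite inE.
  by move=> _; constructor 2.
case: (set_0Vmem A) => [A0|[g0 g0A]].
  by apply: IH => //; rewrite A0 cards0.
have go B m s1 : B \subset A -> (m.*2 <= #|B|)%N -> (0 < #|B|)%N ->
    (forall v, v \in B -> t v \in B) -> absorbed m s B s1 ->
    (forall v, [disjoint porbit s v & A] -> s1 v = s v) ->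
    (forall v, v \in A -> v \notin B -> s1 (s1 v) != v ->
       [disjoint porbit s v & B] /\ {in porbit s v, s1 =1 s}) ->
    exists s', absorbed #|A|./2 s A s'.
  move=> sBA mB B0 clB ab d1 h.
  have EA : (#|A :\: B| = #|A| - #|B|)%N by rewrite cardsD (setIidPr sBA).
  have BA := subset_leq_card sBA.
  have [||||s' ab'] := IH (A :\: B) s1.
  - by rewrite EA; lia.
  - by case: ab.
  - move=> v; rewrite inE => /andP [vB vA]; have [h1 h2 h3 h4] := mA v vA; split => //.
    rewrite inE h1 andbT; apply: contra vB => /clB; by rewrite h3.
  - exact: breakable_sub brA h.
  exists s'; have [c' r' e' n' d'] := absorbed_trans sBA clB ab d1 ab'; split => //.
  by apply: reach_le r'; rewrite EA; lia.
have pairP g : g \in A -> [/\ [set g; t g] \subset A, #|[set g; t g]| = 2 &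
    forall v, v \in [set g; t g] -> t v \in [set g; t g]].
  move=> gA; have [h1 h2 h3 h4] := mA g gA; split.
  - by apply/subsetP => v; rewrite !inE => /pred2P [] ->.
  - by rewrite cards2 eq_sym h2.
  - by move=> v; rewrite !inE => /pred2P [] ->; rewrite ?h3 eqxx ?orbT.
(* A matching edge between different orbits of [s] is gained by one [join]. *)
have [/exists_inP [g gA nP]|/exists_inPn allP] :=
    boolP [exists g in A, t g \notin porbit s g].
  have [h1 h2 h3 h4] := mA g gA; have [p1 p2 p3] := pairP g gA.
  have ab := absorbed_join cs h4 h3 nP.
  apply: (go [set g; t g] 1%N (join s g (t g))) => //; rewrite ?p2 //.
    move=> v d; rewrite join_out //; exact: (disjoint_notin _ d).
  move=> v vA vB c1.
  have nv : v \notin porbit s g :|: porbit s (t g).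
    by apply: contraNN c1 => h; rewrite (join_involutive nP) //; right.
  move: (nv); rewrite inE negb_or => /andP [v1 v2].
  have out u x : u \in porbit s v -> v \notin porbit s x -> u \notin porbit s x.
    by move=> uv; apply: contra => ux; rewrite -(porbit_trans ux) porbit_sym.
  split => [|u uv]; last by rewrite join_out // out.
  rewrite disjoint_sym disjoint_subset; apply/subsetP => u; rewrite !inE.
  by move=> /pred2P [] ->; rewrite porbit_sym.
have inP g : g \in A -> t g \in porbit s g by move=> gA; apply/negPn; apply: allP.
have [h1 h2 h3 h4] := mA g0 g0A; have [p1 p2 p3] := pairP g0 g0A.
(* Every matching edge now stays within one orbit of [s]. On an orbit of size 2 it is already an
   edge of [s] and costs nothing. *)
have [sg|cg] := eqVneq (s (s g0)) g0.
  have Es : t g0 = s g0.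
    have := inP g0 g0A; rewrite (porbit_pair sg) !inE => /pred2P [E|//].
    by rewrite E eqxx in h2.
  apply: (go [set g0; t g0] 0%N s) => //; rewrite ?p2 //.
    split => //; first exact: reach_refl.
      by move=> v; rewrite !inE => /pred2P [->|->]; rewrite ?h3 Es.
    by move=> v _; constructor 2.
  move=> v vA vB c1; split => //.
  rewrite disjoint_sym disjoint_subset; apply/subsetP => u; rewrite !inE.
  move=> uB; apply: contra c1 => uv.
  by rewrite -(sinv_porbit uv); case/pred2P: uB => ->; rewrite ?Es !sg.
have on0 := conf_odd cs cg.
(* Only the second alternative of [breakable] is left. *)
have [a [ag aA saA]] : exists a, [/\ a \in porbit s g0, a \in A & s a \in A].
  case: (brA g0 g0A cg) => // -[g [gP gA]].
  by rewrite -(porbit_trans gP) inP.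
have ca : s (s a) != a by rewrite (sinv_porbit ag).
(* Exposing the predecessor of [a] pairs [a] with its successor [b] and turns the rest of the cycle
   into edges of value 1. *)
pose z := s^-1%g a; pose s1 := expose s z; pose b := s a.
have sz : s z = a by rewrite permKV.
have poz : porbit s z = porbit s a by rewrite -sz porbit_step.
have zP : z \in porbit s a by rewrite -poz porbit_id.
have cz : s (s z) != z by rewrite (sinv_porbit zP).
have c1 : conf s1 by apply: conf_expose.
have s1a : s1 a = b by rewrite /s1 -{1}sz expose_next // sz.
have s1b : s1 b = a by rewrite -s1a exposeK // poz porbit_id.
have s1K v : v \in porbit s a -> s1 (s1 v) = v by rewrite -poz; apply: exposeK.
have cl1 u : u \in porbit s a -> s1 u \in porbit s a by rewrite -poz mem_expose.
have r1 : reach 1 s s1 by apply: reach1; apply: skel_adj_expose.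
have out1 v : v \notin porbit s a -> s1 v = s v by rewrite -poz; apply: expose_out.
have disj v B : B \subset porbit s a -> v \notin porbit s a -> [disjoint porbit s v & B].
  move=> sB nv; rewrite disjoint_sym disjoint_subset; apply/subsetP => u uB.
  rewrite inE; apply: contra nv => uv.
  by rewrite -(porbit_trans (subsetP sB _ uB)) porbit_sym.
have outo u v : u \in porbit s v -> v \notin porbit s a -> u \notin porbit s a.
  by move=> uv; apply: contra => ux; rewrite -(porbit_trans ux) porbit_sym.
(* If [a b] is a matching edge, this one step gains it. Otherwise a second step exchanges it for the
   matching edges at [a] and at [b], so two steps settle four nodes. *)
have [ta|nta] := eqVneq (t a) b.
  have [q1 q2 q3] := pairP a aA; have [k1 k2 k3 k4] := mA a aA.
  have sub : [set a; t a] \subset porbit s a.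
    by apply/subsetP => u; rewrite !inE => /pred2P [] ->; rewrite ?ta ?porbit_id ?mem_porbit1.
  apply: (go [set a; t a] 1%N s1) => //; rewrite ?q2 //.
  - split => //.
    + by move=> v; rewrite !inE => /pred2P [->|->]; rewrite ?k3 ?ta // s1a ta.
    + by move=> v _; apply: expose_neighbour.
    + move=> v d; apply: out1; apply: (disjoint_notin _ d); by rewrite !inE eqxx.
  - by move=> v d; apply: out1; apply: (disjoint_notin _ d).
  - move=> v vA vB cv; have nv : v \notin porbit s a by apply: contra cv => /s1K ->.
    by split => [|u uv]; [apply: disj | rewrite out1 // (outo u v)].
pose a' := t a; pose b' := t b.
have [k1 k2 k3 k4] := mA a aA; have [l1 l2 l3 l4] := mA b saA.
have nba : b != a by apply: contraNneq ca => E; rewrite -[s a]/b !E -/b E.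
have a'P : a' \in porbit s a by apply: inP.
have b'P : b' \in porbit s a by rewrite -(porbit_step s a); apply: inP.
have na'b' : a' != b' by rewrite (inj_eq perm_inj) eq_sym.
have nb'a : b' != a by apply: contraNneq nta => E; rewrite -E /b' l3.
have nab : a != b by rewrite eq_sym.
pose s2 := join (join s1 a a') b b'.
have J1 := s1K _ a'P; have J2 := s1K _ b'P.
have cs2 : conf s2 by apply: join2_conf.
have E1 : s2 a = a' by apply: (join2_a adj_irr).
have E2 : s2 a' = a by apply: (join2_a' adj_irr).
have E3 : s2 b = b' by exact: joinL.
have E4 : s2 b' = b by apply: (join2_b' adj_irr).
have sub : [set a; b; a'; b'] \subset porbit s a.
  apply/subsetP => u; rewrite !inE -!orbA => /or4P [] /eqP -> //; rewrite ?porbit_id //.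
  exact: mem_porbit1.
have s2K v : v \in porbit s a -> s2 (s2 v) = v.
  by move=> vP; apply: (join2_involutive adj_irr) => //; apply: s1K.
have out2 v : v \notin porbit s a -> s2 v = s v.
  move=> vP; rewrite -out1 //; apply: (join2_out adj_irr) => //.
  - by apply: contra vP; apply: (subsetP (porbit_sub cl1 (porbit_id s a))).
  - by apply: contra vP; apply: (subsetP (porbit_sub cl1 a'P)).
  - by apply: contra vP; apply: (subsetP (porbit_sub cl1 b'P)).
have c4 : #|[set a; b; a'; b']| = 4.
  have -> : [set a; b; a'; b'] = [set x in [:: a; b; a'; b']].
    by apply/setP => x; rewrite !inE -!orbA.
  rewrite cardsE; apply/card_uniqP.
  by rewrite /= !inE !negb_or nab (eq_sym a) k2 (eq_sym a) nb'a (eq_sym b) nta (eq_sym b) l2 na'b'.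
apply: (go [set a; b; a'; b'] 2%N s2); rewrite ?c4 //.
- by apply/subsetP => u; rewrite !inE -!orbA => /or4P [] /eqP ->.
- move=> v; rewrite !inE -!orbA => /or4P [] /eqP ->; rewrite ?k3 ?l3 ?eqxx ?orbT //.
- split => //.
  + apply: (@reach_trans _ _ _ 1 1 _ s1) => //; apply: reach1.
    exact: skel_adj_join2.
  + move=> v; rewrite !inE -!orbA => /or4P [] /eqP ->; rewrite ?k3 ?l3 //.
  + move=> v; rewrite !inE !negb_or -!andbA => /and4P [va vb va' vb'].
    apply: (@near_trans _ s s1); try exact: expose_neighbour.
    by apply: (join2_near adj_irr).
  + move=> v d; apply: out2; apply: (disjoint_notin _ d); by rewrite !inE eqxx.
- by move=> v d; apply: out2; apply: (disjoint_notin _ d).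
- move=> v vA vB cv; have nv : v \notin porbit s a by apply: contra cv => /s2K ->.
  by split => [|u uv]; [apply: disj | rewrite out2 // (outo u v)].
Qed.

End Absorb.

(** * Induction on the set of nodes where two configurations may differ *)

Section Upper.
Variables (R : realType) (V : finType) (adj : rel V).
Hypotheses (adj_sym : symmetric adj) (adj_irr : irreflexive adj).
Notation P := (@frac_matching_polytope R V adj).
Notation conf := (conf adj).
Notation xv := (@xv R V adj).
Notation reach := (@reach R V adj).
Notation score := (score R).
Implicit Types (s t r : {perm V}) (A S W : {set V}).

Definition closed s W := forall v, v \in W -> s v \in W.

(** One stage of the induction. The vertex of [r] pays for the steps at both ends, and its support
    in [S] allows payments of successive stages to be multiplied together. *)
Variant progress W s t : Prop :=
  Progress S s1 t1 r k1 k2 of S \subset W & S != set0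
    & conf s1 & conf t1 & reach k1 s s1 & reach k2 t t1
    & (forall v, v \notin W -> s1 v = s v) & (forall v, v \notin W -> t1 v = t v)
    & closed s1 S & {in S, s1 =1 t1}
    & conf r & (forall v, v \notin S -> r v = v) & (k1 + k2)%:R <= score r.

Lemma progress_sym W s t : progress W s t -> progress W t s.
Proof.
case=> S s1 t1 r k1 k2 h1 h2 h3 h4 h5 h6 h7 h8 h9 h10 h11 h12 h13.
apply: (@Progress _ _ _ S t1 s1 r k2 k1) => //.
- by move=> v vS; rewrite -h10 // h9.
- by move=> v vS; rewrite h10.
- by rewrite addnC.
Qed.

Lemma conf_tperm a b : adj a b -> conf (link a b 1%g) /\ score (link a b 1%g) = 1.
Proof.
move=> ab; split; first by apply: conf_link; rewrite ?conf1 ?perm1.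
by rewrite score_link ?score1 ?add0r ?perm1 // (adj_neq adj_irr).
Qed.

Lemma closed_orbit_notin t W a v : closed t W -> a \in W -> v \notin W -> v \notin porbit t a.
Proof. by move=> cl aW; apply: contra; apply: (subsetP (porbit_sub cl aW)). Qed.

Lemma join_off t W a b v : closed t W -> a \in W -> b \in W -> b \notin porbit t a ->
  v \notin W -> join t a b v = t v.
Proof. by move=> cl aW bW nab vW; rewrite join_out // (closed_orbit_notin cl). Qed.

Lemma progress_matched W s t a : conf s -> conf t -> closed s W -> closed t W ->
  a \in W -> s (s a) = a -> s a \notin porbit t a -> progress W s t.
Proof.
move=> cs ct clS clT aW sa nP; set b := s a in sa nP.
have bW : b \in W by apply: clS.
have nba : b != a by apply: contraNneq nP => ->; rewrite porbit_id.
have ab : adj a b by apply: conf_adj.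
have [cr sr] := conf_tperm ab.
apply: (@Progress _ _ _ [set a; b] s (join t a b) (link a b 1%g) 0 1) => //.
- by apply/subsetP => v; rewrite !inE => /pred2P [] ->.
- by apply/set0Pn; exists a; rewrite !inE eqxx.
- exact: conf_join.
- exact: reach_refl.
- by apply: reach1; apply: skel_adj_join.
- by move=> v; apply: join_off.
- by move=> v; rewrite !inE => /pred2P [] ->; rewrite ?sa eqxx ?orbT.
- by move=> v; rewrite !inE => /pred2P [] ->; rewrite ?joinL // joinR.
- by move=> v; rewrite !inE negb_or => /andP [va vb]; rewrite linkD // perm1.
- by rewrite sr.
Qed.

Lemma progress_common W s t v : conf s -> conf t -> closed s W -> v \in W ->
  s (s v) = v -> t (t v) = v -> s v \in porbit t v -> t v \in porbit s v ->
  progress W s t.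
Proof.
move=> cs ct clS vW sv tv; rewrite (porbit_pair sv) (porbit_pair tv) !inE => h1 h2.
have E : s v = t v.
  case/pred2P: h1 => // e1; case/pred2P: h2 => // e2; by rewrite e1 e2.
apply: (@Progress _ _ _ [set v; s v] s t 1%g 0 0) => //; try exact: reach_refl.
- by apply/subsetP => u; rewrite !inE => /pred2P [] ->; rewrite ?clS.
- by apply/set0Pn; exists v; rewrite !inE eqxx.
- by move=> u; rewrite !inE => /pred2P [] ->; rewrite ?sv eqxx ?orbT.
- by move=> u; rewrite !inE => /pred2P [] ->; rewrite ?sv ?E ?tv.
- exact: conf1.
- by move=> u _; rewrite perm1.
- by rewrite score1.
Qed.

Lemma expose_matching t b : conf t -> t (t b) != b ->
  matching_on adj (expose t b) (porbit t b :\ b).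
Proof.
move=> ct cb v; rewrite !inE => /andP [nv vD].
have nf : expose t b v != v.
  by apply: contraNneq nv => /expose_fixed -> //; apply: conf_odd ct cb.
split => //; last by apply: conf_adj => //; apply: conf_expose.
  by rewrite mem_expose vD andbT -{2}(expose_self t b) (inj_eq perm_inj).
exact: exposeK.
Qed.

Lemma closed_disjoint s W A v : closed s W -> A \subset W -> v \notin W ->
  [disjoint porbit s v & A].
Proof.
move=> cl sAW vW; rewrite disjoint_sym disjoint_subset; apply/subsetP => u uA.
rewrite inE porbit_sym; apply: contra vW; apply/subsetP/porbit_sub => //.
exact: (subsetP sAW).
Qed.

(** Exposing [b] in the cycle [D] of [t] costs one step, and absorbing the remaining matching into
    [s] at most [(#|D| - 1) / 2]. The total [(#|D| + 1) / 2] is the score of that cycle, which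
    therefore pays. *)
Lemma progress_absorb W s t b : conf s -> conf t -> closed s W -> closed t W ->
  b \in W -> s (s b) = b -> t (t b) != b -> s b \in porbit t b ->
  breakable (expose t b) s (porbit t b :\ b) -> progress W s t.
Proof.
move=> cs ct clS clT bW sb cb sbD br.
set D := porbit t b in sbD br *; set t' := expose t b in br *; set A := D :\ b in br *.
have on : odd #|D| := conf_odd ct cb.
have mA : matching_on adj t' A := expose_matching ct cb.
have [s' [c' r' e' n' d']] := absorb_matching R adj_sym adj_irr (leqnn #|A|) cs mA br.
have clA u : u \in A -> s' u \in A by move=> uA; rewrite e' //; case: (mA u uA).
have bA : b \notin A by rewrite !inE eqxx.
have sDW : D \subset W by apply: porbit_sub.
(* The image of [b] is [b] or its old neighbour in [D]. A neighbour other than [b] lies in [A],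
   which is closed under [s'] and does not contain [b]. *)
have s'b : s' b = b.
  have : s' b \notin A by rewrite (mem_closed _ clA).
  have E : s^-1%g b = s b by rewrite -{1}sb permK.
  rewrite !inE negb_and negbK; case: (n' b bA) => [//|->|->]; rewrite ?E sbD orbF => /eqP //.
have eD : {in D, s' =1 t'}.
  move=> v vD; have [->|nv] := eqVneq v b; first by rewrite s'b /t' expose_self.
  by rewrite e' // !inE nv.
have [r [cr fr sr]] := conf_restrict R ct (@porbit_closed V t b).
apply: (@Progress _ _ _ D s' t' r #|A|./2 1) => //.
- by apply/set0Pn; exists b; rewrite porbit_id.
- exact: conf_expose.
- by apply: reach1; apply: skel_adj_expose.
- by move=> v vW; apply: d'; apply: (closed_disjoint clS) vW; rewrite subDset subsetU // sDW orbT.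
- by move=> v vW; apply: expose_out; apply: closed_orbit_notin vW.
- by move=> v vD; rewrite eD // mem_expose.
- rewrite sr sum_weight_cycle // -/D.
  have -> : #|D| = (#|A|).+1 by rewrite (cardsD1 b D) porbit_id.
  have : (#|A|./2 + 1)%:R * 2 <= (#|A|.+1 + 1)%:R :> R.
    by rewrite -natrM ler_nat; lia.
  by rewrite [X in _ <= X]natrD; lra.
Qed.

(** Failure of [breakable] yields a cycle [C] of [s] with no two consecutive nodes in [A], such that
    the matching edges at its nodes in [A] stay inside [C]. One [join] at each end makes two edges
    common, one leaving [C] and one leaving [D], and these two edges pay. *)
Lemma progress_cross W s t b : conf s -> conf t -> closed s W -> closed t W ->
  b \in W -> s (s b) = b -> t (t b) != b ->
  ~ breakable (expose t b) s (porbit t b :\ b) -> progress W s t.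
Proof.
move=> cs ct clS clT bW sb cb nbr.
set D := porbit t b in nbr; set t' := expose t b in nbr; set A := D :\ b in nbr.
have mA : matching_on adj t' A := expose_matching ct cb.
have [v [vA [cv n12]]] : exists v, v \in A /\ s (s v) != v /\
    ~ ((exists g, [/\ g \in porbit s v, g \in A & t' g \notin porbit s v]) \/
       (exists g, [/\ g \in porbit s v, g \in A & s g \in A])).
  apply: contrapT => h; apply: nbr => v vA cv; apply: contrapT => n12.
  by apply: h; exists v.
set C := porbit s v in n12.
have onC : odd #|C| := conf_odd cs cv.
have n1 g : g \in C -> g \in A -> t' g \in C.
  by move=> gC gA; apply: contraT => n; case: n12; left; exists g.
have n2 g : g \in C -> g \in A -> s g \notin A.
  by move=> gC gA; apply: contraT => /negPn n; case: n12; right; exists g.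
have bC : b \notin C by apply: contra cv => bC; rewrite -(sinv_porbit bC) sb.
have DA u : u \in C -> u \in D -> u \in A.
  by move=> uC uD; rewrite !inE uD andbT; apply: contraNneq bC => <-.
have vD : v \in D by move: vA; rewrite !inE => /andP [].
(* As [b] lies in [D] but not in [C], the cycle [D] must enter [C] somewhere: [g] is an entry point,
   and its predecessor is still outside. *)
have [g [gC gD b'C]] : exists g, [/\ g \in C, g \in D & t^-1%g g \notin C].
  apply: contrapT => h; case/negP: bC.
  have cl u : u \in C :&: D -> t^-1%g u \in C :&: D.
    rewrite !inE mem_porbit_inv => /andP [uC uD]; rewrite uD andbT.
    by apply: contraT => n; case: h; exists u.
  have vCD : v \in C :&: D by rewrite !inE porbit_id.
  have := subsetP (porbit_sub cl vCD) b; rewrite porbitV (porbit_trans vD) porbit_id.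
  by rewrite inE => /(_ isT) /andP [].
have gA := DA g gC gD; pose b' := t^-1%g g; pose h := t g.
have [_ t'n _ _] := mA g gA.
have t'g : t' g = h.
  case: (expose_neighbour t b g) => // E; first by move: t'n; rewrite /t' E eqxx.
  by have := n1 g gC gA; rewrite /t' E (negbTE b'C).
have hC : h \in C by rewrite -t'g n1.
have hD : h \in D by rewrite mem_porbit_step.
have hA := DA h hC hD.
have ngh : h != g by rewrite -t'g.
have pog : porbit s g = C by apply: porbit_trans.
have poh : porbit t h = D by apply: porbit_trans.
have cg : s (s g) != g by rewrite (sinv_porbit gC).
have ch : t (t h) != h by rewrite (sinv_porbit hD).
(* The mate of [h] once [C] is broken at [g]. It is a neighbour of [h] on [C], hence outside [D], so
   [h p] can be joined in [t]. *)
pose p := expose s g h.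
have hg : h \in porbit s g by rewrite pog.
have pC : p \in C by rewrite -pog mem_expose pog.
have nph : p != h.
  by apply: contraNneq ngh => /expose_fixed -> //; rewrite pog.
have npg : p != g.
  by apply: contraNneq ngh => E; apply/eqP/(@perm_inj _ (expose s g)); rewrite expose_self.
have pD : p \notin D.
  apply/negP => pD; have pA := DA p pC pD; rewrite /p in pA nph pC.
  case: (expose_neighbour s g h) => E; rewrite E in pA nph pC.
  - by rewrite eqxx in nph.
  - by have := n2 h hC hA; rewrite pA.
  - by have := n2 _ pC pA; rewrite permKV hA.
have b'D : b' \in D by rewrite mem_porbit_inv.
have b'P : b' \notin porbit s g by rewrite pog.
have pP : p \notin porbit t h by rewrite poh.
have tb' : t b' = g by rewrite permKV.
have nb'g : b' != g by apply: contraNneq b'C => E; rewrite -/b' E.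
have nb'h : b' != h by apply: contraNneq b'C => E; rewrite -/b' E.
have agb : adj g b' by apply: conf_adj_inv.
have ahp : adj h p by apply: conf_adj => //; apply: conf_expose.
pose s1 := join s g b'; pose t1 := join t h p.
have s1g : s1 g = b' by apply: joinL.
have s1b' : s1 b' = g by apply: joinR.
have s1h : s1 h = p by rewrite /s1 join_inL // pog.
have s1p : s1 p = h by rewrite /s1 join_inL ?pog // /p exposeK.
have t1h : t1 h = p by apply: joinL.
have t1p : t1 p = h by apply: joinR.
have gE : g = t^-1%g h by rewrite permK.
have onD : odd #|porbit t h| by rewrite poh (conf_odd ct cb).
(* Breaking [D] at [h] pairs [g], the predecessor of [h], with its own predecessor [b'], which is
   also the mate of [g] in [s1]. *)
have t1g : t1 g = b'.
  by rewrite /t1 join_inL ?poh // 1?eq_sym // gE expose_prev // -gE.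
have t1b' : t1 b' = g by rewrite -t1g /t1 join_involutive //; right; rewrite inE poh gD.
have gW : g \in W by apply: (subsetP (porbit_sub clT bW)).
have b'W : b' \in W by apply: (subsetP (porbit_sub clT bW)).
have hW : h \in W by apply: (subsetP (porbit_sub clT bW)).
have vW : v \in W by apply: (subsetP (porbit_sub clT bW)).
have pW : p \in W by apply: (subsetP (porbit_sub clS vW)).
have [cr1 sr1] := conf_tperm agb; set r1 := link g b' 1%g in cr1 sr1.
have npb' : p != b' by apply: contraNneq b'C => E; rewrite -/b' -E.
have r1h : r1 h = h by rewrite linkD ?perm1 // eq_sym.
have r1p : r1 p = p by rewrite linkD ?perm1.
apply: (@Progress _ _ _ [set g; b'; h; p] s1 t1 (link h p r1) 1 1) => //.
- by apply/subsetP => u; rewrite !inE -!orbA => /or4P [] /eqP ->.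
- by apply/set0Pn; exists g; rewrite !inE eqxx.
- exact: conf_join.
- exact: conf_join.
- by apply: reach1; apply: skel_adj_join.
- by apply: reach1; apply: skel_adj_join.
- by move=> u; apply: join_off.
- by move=> u; apply: join_off.
- move=> u; rewrite !inE -!orbA => /or4P [] /eqP ->.
  + by rewrite s1g eqxx ?orbT.
  + by rewrite s1b' eqxx ?orbT.
  + by rewrite s1h eqxx ?orbT.
  + by rewrite s1p eqxx ?orbT.
- move=> u; rewrite !inE -!orbA => /or4P [] /eqP ->.
  + by rewrite s1g t1g.
  + by rewrite s1b' t1b'.
  + by rewrite s1h t1h.
  + by rewrite s1p t1p.
- exact: conf_link.
- move=> u; rewrite !inE !negb_or -!andbA => /and4P [u1 u2 u3 u4].
  by rewrite !linkD // perm1.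
- by rewrite score_link // ?sr1 // eq_sym.
Qed.

Definition cycle_nodes t W := [set v in W | t (t v) != v].

Lemma expose_involutive t a v : t (t v) = v \/ v \in porbit t a ->
  expose t a (expose t a v) = v.
Proof.
case: (boolP (v \in porbit t a)) => [vP _|nP [E|//]]; first exact: exposeK.
by rewrite !expose_out ?mem_porbit_step.
Qed.

(* Two [t]-cycles joined by an edge of [s] are merged into a matching in one step. *)
Lemma merge_cycles n W s t : (#|cycle_nodes t W| <= n)%N -> conf s -> conf t ->
  closed s W -> closed t W -> (forall v, v \in W -> s v != v) ->
  (forall v, v \in W -> t v != v) ->
  exists t' k, [/\ conf t', reach k t t', forall v, v \notin W -> t' v = t v,
    k%:R + score t' = score t &
    (forall v, v \in W -> t' v != v) /\
    (forall u, u \in W -> t' (t' u) != u -> t' (t' (s u)) != s u -> s u \in porbit t' u)].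
Proof.
elim: n t => [|n IH] t cn cs ct clS clT sW tW.
  exists t, 0%N; split => //; [exact: reach_refl | by rewrite add0r |].
  split => // u uW cu; move: cn; rewrite leqn0 cards_eq0 => /eqP /setP /(_ u).
  by rewrite !inE uW cu.
have [/existsP [u /and4P [uW cu csu nP]]|/existsPn h] := boolP [exists u,
    [&& u \in W, t (t u) != u, t (t (s u)) != s u & s u \notin porbit t u]]; last first.
  exists t, 0%N; split => //; [exact: reach_refl | by rewrite add0r |].
  split => // u uW cu csu; have := h u; rewrite uW cu csu /=.
  by rewrite negbK.
have suW := clS _ uW.
have au : adj u (s u) by apply: conf_adj => //; apply: sW.
pose t1 := join t u (s u).
have off1 v : v \notin W -> t1 v = t v by apply: join_off.
have ct1 : conf t1 by apply: conf_join.
have clT1 : closed t1 W.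
  have clC v : v \in ~: W -> t1 v \in ~: W.
    by rewrite !inE => vW; rewrite off1 // (mem_closed _ clT).
  by move=> v; have := mem_closed v clC; rewrite !inE => /negb_inj ->.
have [|||||||t' [k [c' r' off' sc' [f' j']]]] := IH t1.
- rewrite -ltnS; apply: leq_trans cn; apply: proper_card; apply/properP; split.
    apply/subsetP => v; rewrite !inE => /andP [-> c1] /=; apply: contra c1 => /eqP E.
    by apply/eqP; apply: join_involutive => //; left.
  exists u; rewrite !inE ?uW //= negbK; apply/eqP/join_involutive => //.
  by right; rewrite inE porbit_id.
- by [].
- by [].
- by [].
- by [].
- by [].
- move=> v vW; have [->|vu] := eqVneq v u; first by rewrite /t1 joinL sW.
  have [->|vsu] := eqVneq v (s u); first by rewrite /t1 joinR // eq_sym sW.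
  case: (boolP (v \in porbit t u)) => v1.
    by rewrite /t1 join_inL //; apply: contraNneq vu => /expose_fixed -> //; apply: conf_odd ct cu.
  case: (boolP (v \in porbit t (s u))) => v2.
    by rewrite /t1 join_inR //; apply: contraNneq vsu => /expose_fixed -> //; apply: conf_odd ct csu.
  by rewrite /t1 join_out // tW.
exists t', k.+1; split => //.
- by apply: (@reach_trans _ _ _ 1 k _ t1) => //; apply: reach1; apply: skel_adj_join.
- by move=> v vW; rewrite off' // off1.
- by move: sc'; rewrite (@score_join _ adj) // -natr1; lra.
Qed.

(** One node of each remaining cycle is exposed. The hypothesis on edges of [s] survives because the
    only newly fixed node [v] stands for its whole former cycle. In the end it says that no edge of
    [s] joins two exposed nodes. *)
Lemma expose_cycles n W s t : (#|cycle_nodes t W| <= n)%N -> conf s -> conf t ->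
  closed t W ->
  (forall u, u \in W -> t u = u \/ t (t u) != u -> t (s u) = s u \/ t (t (s u)) != s u ->
     s u \in porbit t u) ->
  exists t' k, [/\ conf t', reach k t t', forall v, v \notin W -> t' v = t v,
    k%:R + score t' = score t &
    (forall v, v \in W -> t' (t' v) = v) /\
    (forall u, u \in W -> t' u = u -> t' (s u) = s u -> s u = u)].
Proof.
elim: n t => [|n IH] t cn cs ct clT J.
  have inv v : v \in W -> t (t v) = v.
    move=> vW; apply/eqP; apply: contraT => cv; move: cn; rewrite leqn0 cards_eq0.
    by move=> /eqP /setP /(_ v); rewrite !inE vW cv.
  exists t, 0%N; split => //; [exact: reach_refl | by rewrite add0r | split => //].
  move=> u uW tu tsu; have := J u uW (or_introl tu) (or_introl tsu).
  by rewrite porbit_pair ?tu // setUid inE => /eqP.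
have [/existsP [v /andP [vW cv]]|/existsPn h] := boolP [exists v, (v \in W) && (t (t v) != v)];
    last first.
  have inv v : v \in W -> t (t v) = v.
    by move=> vW; have := h v; rewrite vW /= negbK => /eqP.
  exists t, 0%N; split => //; [exact: reach_refl | by rewrite add0r | split => //].
  move=> u uW tu tsu; have := J u uW (or_introl tu) (or_introl tsu).
  by rewrite porbit_pair ?tu // setUid inE => /eqP.
pose t1 := expose t v.
have off1 u : u \notin porbit t v -> t1 u = t u by apply: expose_out.
have on := conf_odd ct cv.
have unm u : t1 u = u \/ t1 (t1 u) != u ->
    (u \notin porbit t v /\ (t u = u \/ t (t u) != u)) \/ u = v.
  case: (boolP (u \in porbit t v)) => uP.
    rewrite exposeK // eqxx => -[E|//]; right; exact: expose_fixed E.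
  by rewrite !off1 ?mem_porbit_step //; left.
have [|||||t' [k [c' r' off' sc' [i' f']]]] := IH t1.
- rewrite -ltnS; apply: leq_trans cn; apply: proper_card; apply/properP; split.
    apply/subsetP => u; rewrite !inE => /andP [-> c1] /=; apply: contra c1 => /eqP E.
    by apply/eqP; apply: expose_involutive; left.
  exists v; rewrite !inE ?vW //= negbK; apply/eqP/expose_involutive.
  by right; rewrite porbit_id.
- by [].
- exact: conf_expose.
- move=> u uW; case: (boolP (u \in porbit t v)) => uP; last by rewrite off1 // clT.
  by apply: (subsetP (porbit_sub clT vW)); rewrite mem_expose.
- move=> u uW /unm [[u1 u2]|->] /unm [[w1 w2]|w].
  + have := J u uW u2 w2.
    rewrite (@porbit_eq_on _ t t1 (~: porbit t v) u) ?inE //.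
      exact: (@porbitC_closed _ t v).
    by move=> z; rewrite inE => zP; rewrite off1.
  + have := J u uW u2; rewrite w cv => /(_ (or_intror isT)).
    by rewrite porbit_sym (negbTE u1).
  + by have := J v vW (or_intror cv) w2; rewrite (negbTE w1).
  + by rewrite w porbit_id.
exists t', k.+1; split => //.
- by apply: (@reach_trans _ _ _ 1 k _ t1) => //; apply: reach1; apply: skel_adj_expose.
- by move=> u uW; rewrite off' // off1 // (closed_orbit_notin clT).
- by move: sc'; rewrite (@score_expose _ _ adj) // -natr1; lra.
Qed.

Lemma score_off W t t' : closed t W -> (forall v, v \notin W -> t' v = t v) ->
  score t - score t' =
  \sum_(v in W) weight R #|porbit t v| - \sum_(v in W) weight R #|porbit t' v|.
Proof.
move=> clT off; rewrite !scoreE (bigID (mem W)) /= [X in _ - X](bigID (mem W)) /=.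
rewrite (eq_bigr (fun v => weight R #|porbit t' v|) (P := fun v => v \notin W)); first by ring.
move=> v vW; congr (weight _ #|pred_of_set _|).
apply: (@porbit_eq_on _ t t' (~: W)); first exact: closedC.
  by move=> u; rewrite inE => /off ->.
by rewrite inE.
Qed.

(** Each step at the end of [t] lowers its score by 1 until a matching on [A] is left, whose score
    [#|A| / 2] on [W] bounds the number of steps at the end of [s]. So the restriction of [t] to [W]
    pays for everything. *)
Lemma progress_all_cycles W s t : W != set0 -> conf s -> conf t ->
  closed s W -> closed t W -> (forall v, v \in W -> s (s v) != v) ->
  (forall v, v \in W -> t (t v) != v) -> progress W s t.
Proof.
move=> W0 cs ct clS clT cyS cyT.
have nfix (x : {perm V}) v : x (x v) != v -> x v != v.
  by apply: contraNneq => E; rewrite !E.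
have [||t1 [k1 [c1 r1 off1 sc1 [f1 j1]]]] := merge_cycles (leqnn _) cs ct clS clT.
- by move=> v vW; apply: nfix; apply: cyS.
- by move=> v vW; apply: nfix; apply: cyT.
have cl_off t0 : (forall v, v \notin W -> t0 v = t v) -> closed t0 W.
  move=> off v; have clC u : u \in ~: W -> t0 u \in ~: W.
    by rewrite !inE => uW; rewrite off // (mem_closed _ clT).
  by have := mem_closed v clC; rewrite !inE => /negb_inj ->.
have [|t' [k2 [c' r2 off2 sc2 [i' f']]]] := expose_cycles (leqnn _) cs c1 (cl_off _ off1).
  move=> u uW [E|h1] [E'|h2]; try by have := f1 u uW; rewrite E eqxx.
    by have := f1 _ (clS _ uW); rewrite E' eqxx.
  exact: j1.
have off v : v \notin W -> t' v = t v by move=> vW; rewrite off2 // off1.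
have clT' := cl_off _ off.
have fx u : u \in W -> t' u = u -> t' (s u) = s u -> False.
  by move=> uW h1 h2; have := nfix s u (cyS u uW); rewrite (f' u uW h1 h2) eqxx.
pose A := [set v in W | t' v != v].
have sAW : A \subset W by apply/subsetP => v; rewrite inE => /andP [].
have mA : matching_on adj t' A.
  move=> v; rewrite inE => /andP [vW nv]; rewrite inE clT' // i' // eq_sym nv.
  by split => //; apply: conf_adj.
(* An odd cycle of [s] has two consecutive nodes that are both fixed or both moved by [t']. They
   cannot both be fixed, so both lie in [A]. *)
have br : breakable t' s A.
  move=> v; rewrite inE => /andP [vW _] cv; right.
  have [u uv E] := odd_not_alternate (fun u => t' u == u) (conf_odd cs cv).
  have uW : u \in W by apply: (subsetP (porbit_sub clS vW)).
  exists u; rewrite !inE uW clS //=; move: E.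
  case: eqP => h1; case: eqP => h2 // _.
  by case: (fx u uW h2 h1).
have [s' [cs' r' e' n' d']] := absorb_matching R adj_sym adj_irr (leqnn #|A|) cs mA br.
have clA u : u \in A -> s' u \in A by move=> uA; rewrite e' //; case: (mA u uA).
(* The [s]-neighbours of a node exposed by [t'] lie in [A], which is closed under [s'], so [s']
   exposes this node as well. *)
have eW : {in W, s' =1 t'}.
  move=> v vW; case: (boolP (v \in A)) => vA; first exact: e'.
  have tv : t' v = v by move: vA; rewrite inE vW /= negbK => /eqP.
  rewrite tv; have : s' v \notin A by rewrite (mem_closed _ clA).
  case: (n' v vA) => // ->; rewrite inE.
    by rewrite clS //= negbK => /eqP h; case: (fx v vW tv h).
  rewrite (mem_closed_inv _ clS) vW /= negbK => /eqP h.
  by case: (fx (s^-1%g v)) => //; rewrite ?permKV // (mem_closed_inv _ clS).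
have [r [cr fr sr]] := conf_restrict R ct clT.
apply: (@Progress _ _ _ W s' t' r #|A|./2 (k1 + k2)) => //.
- exact: reach_trans r1 r2.
- by move=> v vW; apply: d'; apply: closed_disjoint vW.
- by move=> v vW; rewrite eW // clT'.
- have := score_off clT off; rewrite sr.
  have -> : \sum_(v in W) weight R #|porbit t' v| = #|A|%:R / 2.
    rewrite (bigID (fun v => t' v != v)) /= [X in _ + X]big1 ?addr0; last first.
      by move=> v /andP [_ /negPn /eqP E]; rewrite weight_fixed.
    rewrite (eq_bigr (fun=> 2^-1)) => [|v /andP [vW nv]]; last by rewrite weight_pair ?i'.
    rewrite (eq_bigl (fun v => v \in A)) => [|v]; last by rewrite inE.
    by rewrite big_const iter_addr_0 -[LHS]mulr_natl.
  have : (#|A|./2)%:R * 2 <= #|A|%:R :> R by rewrite -natrM ler_nat; lia.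
  by rewrite !natrD; lra.
Qed.

Lemma progress_exists W s t : W != set0 -> conf s -> conf t ->
  closed s W -> closed t W -> progress W s t.
Proof.
move=> W0 cs ct clS clT.
have half x y : conf x -> conf y -> closed x W -> closed y W ->
    [exists a in W, (x (x a) == a) && (x a \notin porbit y a)] -> progress W x y.
  move=> cx cy clX clY /exists_inP [a aW /andP [/eqP h1 h2]].
  exact: progress_matched h1 h2.
case: (boolP [exists a in W, (s (s a) == a) && (s a \notin porbit t a)]) => [|/exists_inPn hs].
  exact: half.
case: (boolP [exists a in W, (t (t a) == a) && (t a \notin porbit s a)]) => [h|/exists_inPn ht].
  by apply: progress_sym; apply: half.
(* From here on, each edge of value 1 of one configuration has both ends on a common orbit of the
   other. *)
have Fs a : a \in W -> s (s a) = a -> s a \in porbit t a.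
  by move=> aW E; have := hs a aW; rewrite E eqxx /= negbK.
have Ft a : a \in W -> t (t a) = a -> t a \in porbit s a.
  by move=> aW E; have := ht a aW; rewrite E eqxx /= negbK.
have one x y b : conf x -> conf y -> closed x W -> closed y W -> b \in W ->
    x (x b) = b -> y (y b) != b -> x b \in porbit y b -> progress W x y.
  move=> cx cy clX clY bW xb yb h.
  have [br|nbr] := pselect (breakable (expose y b) x (porbit y b :\ b)).
    exact: progress_absorb br.
  exact: progress_cross nbr.
case: (boolP [exists a in W, s (s a) == a]) => [/exists_inP [b bW /eqP sb]|/exists_inPn hs'].
  have [tb|tb] := eqVneq (t (t b)) b.
    by apply: (@progress_common W s t b) => //; [apply: Fs | apply: Ft].
  by apply: (one s t b) => //; apply: Fs.
case: (boolP [exists a in W, t (t a) == a]) => [/exists_inP [b bW /eqP tb]|/exists_inPn ht'].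
  by apply: progress_sym; apply: (one t s b) => //; [apply: hs' | apply: Ft].
exact: progress_all_cycles.
Qed.

Lemma reach_bound n W s t : (#|W| <= n)%N -> conf s -> conf t ->
  closed s W -> closed t W -> (forall v, v \notin W -> s v = t v) ->
  exists r k, [/\ conf r, forall v, v \notin W -> r v = v, reach k s t & k%:R <= score r].
Proof.
elim: n W s t => [|n IH] W s t cW cs ct clS clT off; (have [W0|W0] := eqVneq W set0).
- have -> : s = t by apply/permP => v; apply: off; rewrite W0 inE.
  exists 1%g, 0%N; split; [exact: conf1 | by move=> v; rewrite perm1 | exact: reach_refl |].
  by rewrite score1.
- by move: cW; rewrite leqn0 cards_eq0 (negbTE W0).
- by apply: IH => //; rewrite W0 cards0.
have [S s1 t1 r k1 k2 sSW S0 c1 c2 r1 r2 o1 o2 clS1 e1 cr fr sr] := progress_exists W0 cs ct clS clT.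
have clW (x y : {perm V}) : closed x W -> (forall v, v \notin W -> y v = x v) -> closed y W.
  move=> cl o v; have clC u : u \in ~: W -> y u \in ~: W.
    by rewrite !inE => uW; rewrite o // (mem_closed _ cl).
  by have := mem_closed v clC; rewrite !inE => /negb_inj ->.
have cls1 := clW _ _ clS o1; have clt1 := clW _ _ clT o2.
have clT1 : closed t1 S by move=> v vS; rewrite -e1 // clS1.
have [||||||r' [k [cr' fr' rk sr']]] := IH (W :\: S) s1 t1.
- rewrite -ltnS; apply: leq_trans cW; rewrite cardsD (setIidPr sSW).
  have := subset_leq_card sSW; have : (0 < #|S|)%N by rewrite card_gt0.
  lia.
- by [].
- by [].
- by move=> v; rewrite !inE => /andP [vS vW]; rewrite cls1 // (mem_closed _ clS1) vS.
- by move=> v; rewrite !inE => /andP [vS vW]; rewrite clt1 // (mem_closed _ clT1) vS.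
- move=> v; rewrite inE negb_and negbK => /orP [vS|vW]; first exact: e1.
  by rewrite o1 // o2 // off.
have fS v : v \in S -> r' v = v by move=> vS; apply: fr'; rewrite inE vS.
have [cm sm] := conf_mul R cr cr' fr fS.
(* The payments [r] and [r'] are supported on [S] and on [W :\: S], so their scores add up as the
   numbers of steps do. *)
exists (r * r')%g, (k1 + (k + k2))%N; split => //.
- move=> v vW; have vS : v \notin S by apply: contra vW; apply: (subsetP sSW).
  by rewrite permM fr // fr' // inE (negbTE vW) andbF.
- exact: reach_trans r1 (reach_trans rk (reach_sym r2)).
- by rewrite sm; move: sr; rewrite !natrD; lra.
Qed.

Lemma conf_walk s t : conf s -> conf t ->
  exists r k, [/\ conf r, skel_walk P (xv s) (xv t) k & k%:R <= score r].
Proof.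
move=> cs ct.
have [||||r [k [cr _ [l lk wl] sr]]] := @reach_bound #|V| setT s t _ cs ct.
- by rewrite cardsT.
- by move=> v; rewrite !inE.
- by move=> v; rewrite !inE.
- by move=> v; rewrite !inE.
by exists r, l; split => //; apply: le_trans sr; rewrite ler_nat.
Qed.

End Upper.

(** * Vertices *)

Section Hall.
Variable T : finType.
Implicit Types (e : rel T) (X : {set T}).

Definition nbrs e X := [set y | [exists x in X, e x y]].

Lemma nbrsP e X y : reflect (exists2 x, x \in X & e x y) (y \in nbrs e X).
Proof. by rewrite inE; apply: exists_inP. Qed.

(* Rado's argument: in a minimal relation satisfying the marriage condition
   every point has a single neighbour, by submodularity of [#|nbrs e _|]. *)
Lemma hall_marriage n e : (#|[set p : T * T | e p.1 p.2]| <= n)%N ->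
  (forall X, (#|X| <= #|nbrs e X|)%N) -> exists2 f : T -> T, injective f & forall x, e x (f x).
Proof.
elim: n e => [|n IH] e cn hall.
  have empty (x : T) : False.
    have : (0 < #|nbrs e [set x]|)%N by rewrite (leq_trans _ (hall _)) ?cards1.
    move=> /card_gt0P [y /nbrsP [z _ ezy]].
    by move: cn; rewrite leqn0 cards_eq0 => /eqP /setP /(_ (z, y)); rewrite !inE /= ezy.
  by exists id => // x; case: (empty x).
have [/existsP [x /existsP [y1 /existsP [y2 /and3P [ny e1 e2]]]]|h] :=
    boolP [exists x, exists y1, exists y2, [&& y1 != y2, e x y1 & e x y2]]; last first.
  have uni x y1 y2 : e x y1 -> e x y2 -> y1 = y2.
    move=> h1 h2; apply/eqP; apply: contraNT h => ny.
    by apply/existsP; exists x; apply/existsP; exists y1; apply/existsP; exists y2; rewrite ny h1.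
  have ex x : exists y, e x y.
    have : (0 < #|nbrs e [set x]|)%N by rewrite (leq_trans _ (hall _)) ?cards1.
    by move=> /card_gt0P [y /nbrsP [z]]; rewrite inE => /eqP -> exy; exists y.
  exists (fun x => xchoose (ex x)); last by move=> x; apply: (xchooseP (ex x)).
  move=> x y /= E; apply/eqP; apply: contraT => nxy.
  have := hall [set x; y]; rewrite cards2 nxy => le2.
  suff : (#|nbrs e [set x; y]| <= 1)%N by move=> le1; have := leq_trans le2 le1.
  rewrite -(cards1 (xchoose (ex x))); apply: subset_leq_card; apply/subsetP => z.
  move=> /nbrsP [w]; rewrite !inE => /pred2P [] -> ewz; apply/eqP.
    exact: uni ewz (xchooseP (ex x)).
  by rewrite E; apply: uni ewz (xchooseP (ex y)).
pose del y : rel T := [rel u v | e u v && ((u, v) != (x, y))].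
have delE y u v : del y u v = e u v && ((u, v) != (x, y)) by [].
have smaller y : e x y -> (#|[set p : T * T | del y p.1 p.2]| <= n)%N.
  move=> exy; rewrite -ltnS; apply: leq_trans cn; apply: proper_card.
  apply/properP; split; first by apply/subsetP => p; rewrite !inE => /andP [].
  by exists (x, y); rewrite inE //= delE eqxx andbF.

have sub y f : (forall u, del y u (f u)) -> forall u, e u (f u) by move=> h u; case/andP: (h u).
have [h1|h1] := pselect (forall X, (#|X| <= #|nbrs (del y1) X|)%N).
  by have [f fi fe] := IH _ (smaller _ e1) h1; exists f => //; apply: sub fe.
have [h2|h2] := pselect (forall X, (#|X| <= #|nbrs (del y2) X|)%N).
  by have [f fi fe] := IH _ (smaller _ e2) h2; exists f => //; apply: sub fe.
(* Deleting the pair [(x, y)] only affects the neighbours of [x], so a violating set contains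
   [x]. *)
have bad y : ~ (forall X, (#|X| <= #|nbrs (del y) X|)%N) ->
    exists X, x \in X /\ (#|nbrs (del y) X| < #|X|)%N.
  move=> h; have [X lt] : exists X, ~~ (#|X| <= #|nbrs (del y) X|)%N.
    by apply: contrapT => n0; apply: h => X; apply: contraT => lt; case: n0; exists X.
  rewrite -ltnNge in lt; exists X; split => //; apply: contraLR lt => xX.
  rewrite -leqNgt; apply: leq_trans (hall X) _; apply: subset_leq_card.
  apply/subsetP => z /nbrsP [u uX uz]; apply/nbrsP; exists u => //.
  rewrite delE uz; apply/eqP => -[ux _]; by rewrite ux (negbTE xX) in uX.
have [X1 [x1 lt1]] := bad y1 h1; have [X2 [x2 lt2]] := bad y2 h2.
set A := nbrs _ X1 in lt1; set B := nbrs _ X2 in lt2.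
have sU : nbrs e (X1 :|: X2) \subset A :|: B.
  apply/subsetP => z /nbrsP [u]; rewrite inE => uX uz.
  have [Eu|nu] := eqVneq u x.
    rewrite Eu in uz; have [zy|zy] := eqVneq z y1.
      rewrite inE; apply/orP; right; apply/nbrsP; exists x => //.
      by rewrite delE uz zy /=; apply/eqP => -[E]; rewrite E eqxx in ny.
    rewrite inE; apply/orP; left; apply/nbrsP; exists x => //.
    by rewrite delE uz /=; apply/eqP => -[E]; rewrite E eqxx in zy.
  have d y : del y u z by rewrite delE uz /=; apply/eqP => -[E]; rewrite E eqxx in nu.
  by rewrite inE; apply/orP; case/orP: uX => uX; [left | right]; apply/nbrsP; exists u.
have sI : nbrs e ((X1 :&: X2) :\ x) \subset A :&: B.
  apply/subsetP => z /nbrsP [u]; rewrite !inE => /and3P [nu u1 u2] uz.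
  have d y : del y u z by rewrite delE uz /=; apply/eqP => -[E]; rewrite E eqxx in nu.
  by apply/andP; split; apply/exists_inP; exists u.
(* The violations give [#|A| + #|B| <= #|X1| + #|X2| - 2], whereas the marriage condition for the
   union and for the intersection without [x] gives at least [#|X1| + #|X2| - 1]. *)
have := leq_trans (hall _) (subset_leq_card sU).
have := leq_trans (hall _) (subset_leq_card sI).
have := cardsUI A B; have := cardsUI X1 X2.
have : #|X1 :&: X2| = (#|(X1 :&: X2) :\ x|).+1 by rewrite (cardsD1 x) inE x1 x2.
lia.
Qed.

End Hall.

(** * Every vertex comes from a configuration *)

Section Vertices.
Variables (R : realType) (V : finType) (adj : rel V).
Hypotheses (adj_sym : symmetric adj) (adj_irr : irreflexive adj).
Notation vec := (vect R (edge adj)).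
Notation P := (@frac_matching_polytope R V adj).
Notation xv := (@xv R V adj).
Implicit Types (s : {perm V}) (x : vec).

(* Slack on the diagonal makes a fractional matching a doubly stochastic
   matrix, whose support therefore contains a permutation. *)
Lemma fmp_perm x : P x -> exists s,
  (forall v, s v != v -> 0 < ev x v (s v)) /\ (forall v, deg x v = 1 -> s v != v).
Proof.
move=> px; have [px0 px1] := (fmpP adj_irr x).1 px.
pose B u v : R := if u == v then 1 - deg x u else ev x u v.
have Bs u v : B u v = B v u.
  by rewrite /B eq_sym; case: eqP => [->|_] //; apply: ev_sym.
have B0 u v : 0 <= B u v.
  by rewrite /B; case: eqP => _; [rewrite subr_ge0 | apply: ev_ge0].
have row u : \sum_v B u v = 1.
  rewrite (bigD1 u) //= {1}/B eqxx (eq_bigr (fun v => ev x u v)) => [|v nv]; last first.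
    by rewrite /B eq_sym (negbTE nv).
  have -> : \sum_(v | v != u) ev x u v = deg x u.
    by rewrite /deg [in RHS](bigD1 u) //= ev_diag // add0r.
  by rewrite subrK.
pose e : rel V := [rel u v | 0 < B u v].
(* The rows in [X] have all their mass in the columns of [N], whose total mass is [#|N|]. *)
have hall (X : {set V}) : (#|X| <= #|nbrs e X|)%N.
  rewrite -(ler_nat R); set N := nbrs _ X.
  have -> : #|X|%:R = \sum_(u in X) \sum_(v in N) B u v :> R.
    rewrite -sum1_card natr_sum; apply: eq_bigr => u uX.
    rewrite -(row u) (bigID (mem N)) /= [X in _ + X]big1 ?addr0 // => v vN.
    apply/eqP; rewrite eq_le B0 andbT leNgt; apply: contra vN => uv.
    by apply/nbrsP; exists u.
  have -> : #|N|%:R = \sum_(v in N) \sum_u B u v :> R.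
    rewrite -sum1_card natr_sum; apply: eq_bigr => v _.
    by rewrite -(row v); apply: eq_bigr => u _; apply: Bs.
  rewrite exchange_big /=; apply: ler_sum => v _.
  by rewrite [leRHS](bigID (mem X)) /= lerDl sumr_ge0.
have [f fi fe] := hall_marriage (leqnn _) hall.
exists (perm fi); split => v; rewrite permE.
  by move=> nv; have := fe v; rewrite /e /= /B eq_sym (negbTE nv).
by move=> dv; apply: contraTneq (fe v) => E; rewrite /e /= /B E eqxx dv subrr ltxx.
Qed.

Lemma even_alternating s v : ~~ odd #|porbit s v| ->
  exists g : V -> R, [/\ g v = 1, forall u, u \notin porbit s v -> g u = 0 &
    forall u, g (s u) = - g u].
Proof.
move=> en; set n := #|porbit s v| in en.
pose idx u := index u (traject s v n).
have idxE i : (i < n)%N -> idx (iter i s v) = i.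
  move=> lti; rewrite /idx -(nth_traject s lti) index_uniq ?size_traject //.
  exact: uniq_traject_porbit.
exists (fun u => if u \in porbit s v then (-1) ^+ (idx u) else 0); split.
- by rewrite porbit_id (idxE 0%N) // card_porbit_gt0.
- by move=> u /negbTE ->.
move=> u; rewrite mem_porbit_step; case: ifP => [/porbit_iter [i lti ->]|]; last by rewrite oppr0.
rewrite -iterS (idxE i) //; move: (lti); rewrite leq_eqVlt => /orP [/eqP E|lti'].
  rewrite E iter_porbit (idxE 0%N) ?card_porbit_gt0 //.
  have oi : odd i by move: en; rewrite /n -E /= negbK.
  by rewrite expr0 -[_ ^+ i]signr_odd oi expr1 opprK.
by rewrite idxE // exprS mulN1r.
Qed.

(** The permutation from [fmp_perm] gives a vector for which all constraints tight at [x] are tight,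
    so its difference from [x] is a kernel direction at a vertex and vanishes. An even orbit of
    length at least 4 would carry a nonzero alternating kernel direction. *)
Lemma vertex_conf x : is_vertex P x -> exists2 s, conf adj s & x = xv s.
Proof.
move=> vx; have px := vertex_fmp vx.
have [s [h1 h2]] := fmp_perm px.
have gs : graphic adj s.
  by move=> v /h1 h; apply: contraLR h => na; rewrite (ev_nadj adj_sym x na) ltxx.
have Ex : x = xv s.
  apply/eqP; rewrite -subr_eq0 -oppr_eq0 opprB; apply/eqP.
  apply: (vertex_kernel adj_irr vx); split => [e xe|v dv].
    have [a [b [ab E]]] := edge_ends e.
    rewrite -(ev_edge _ E) evD evN (ev_edge x E) xe subr0 ev_xv_adj //.
    have na (u w : V) : adj u w -> ev x u w = 0 -> (s u == w) = false.
      move=> uw e0; apply/eqP => su; have := h1 u.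
      by rewrite su e0 ltxx eq_sym (adj_neq adj_irr uw) => /(_ isT).
    have e1 : ev x a b = 0 by rewrite (ev_edge x E).
    by rewrite !na ?addr0 ?mul0r // 1?adj_sym // ev_sym.
  by rewrite degD degN dv deg_xv_graphic // h2 // subrr.
exists s => //; apply/forallP => v; apply/andP; split.
  by case: eqP => // /eqP /gs.
rewrite -implyNb; apply/implyP => cv; apply: contraT => en.
have nv : s v != v by apply: contraNneq cv => E; rewrite !E.
have [g [g1 g0 ga]] := even_alternating en.
have : wv adj g s = 0.
  apply: (vertex_kernel adj_irr vx); split => [e|u _]; last first.
    by have := ga (s^-1%g u); rewrite permKV deg_wv // => ->; rewrite addNr mulr0.
  have [a [b [ab E]]] := edge_ends e.
  rewrite -!(ev_edge _ E) Ex ev_xv_adj // ev_wv //.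
  by case: eqP => _; case: eqP => _ //=; rewrite ?mul0r ?addr0 //; lra.
move=> /(congr1 (fun d => ev d v (s v))); rewrite ev_wv ?gs // eqxx (negbTE cv) g1.
rewrite [RHS]big1 => [|e _]; last by rewrite ffunE.
by rewrite mul0r addr0 mul1r => /eqP; rewrite oner_eq0.
Qed.

End Vertices.

(** * Cycles of half-edges *)

Lemma next_next_neq (T : eqType) (c : seq T) v : uniq c -> (2 < size c)%N -> v \in c ->
  next c (next c v) != v.
Proof.
move=> uc sc vc; have [i p E] := rot_to vc.
have up : uniq (v :: p) by rewrite -E rot_uniq.
rewrite -!(next_rot i uc) E.
have : (2 < size (v :: p))%N by rewrite -E size_rot.
case: p E up => [|y [|z p]] //= _ /and3P [] nv; rewrite eqxx => ny _ _.
move: nv; rewrite !inE !negb_or => /and3P [vy vz _].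
by rewrite [y == v]eq_sym (negbTE vy) eqxx eq_sym.
Qed.

Section HalfCycles.
Variables (R : realType) (V : finType) (adj : rel V).
Hypotheses (adj_sym : symmetric adj) (adj_irr : irreflexive adj).
Notation xv := (@xv R V adj).
Variable s : {perm V}.
Hypothesis cs : conf adj s.

Definition long_orbits := [set O in porbits s | (2 < #|O|)%N].

Definition orbit_edges (O : {set V}) : {set edge adj} :=
  [set e : edge adj | [exists v in O, val e == [set v; s v]]].

Lemma orbit_edgesP (O : {set V}) (e : edge adj) :
  reflect (exists2 v, v \in O & val e = [set v; s v]) (e \in orbit_edges O).
Proof.
rewrite inE; apply: (iffP exists_inP) => [[v vO /eqP E]|[v vO E]]; exists v => //.
exact/eqP.
Qed.

Lemma half_edge u v : adj u v -> ev (xv s) u v = 2^-1 ->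
  (s u = v \/ v = s^-1%g u) /\ s (s u) != u.
Proof.
have n1 : (1%:R + 1%:R) / 2 <> 2^-1 :> R by lra.
have n0 : (0%:R + 0%:R) / 2 <> 2^-1 :> R by lra.
move=> uv; rewrite ev_xv_adj //.
case: (s u =P v) => [<-|h1]; case: eqP => [h2|h2] /= E.
- by case: n1.
- by split; [left | apply/eqP].
- split; first by right; rewrite -h2 permK.
  by apply/eqP => h; apply: h1; apply: (@perm_inj _ s); rewrite h -h2.
- by case: n0.
Qed.

Lemma long_orbit_cycle v : s (s v) != v -> exists c : seq V,
  [/\ (2 < size c)%N, ucycle adj c, c =i porbit s v & {in c, next c =1 s}].
Proof.
move=> cv; pose n := #|porbit s v|.
have n2 : (2 < n)%N by rewrite ltnNge card_porbit_le2.
have memc : traject s v n =i porbit s v by move=> u; rewrite -porbit_traject.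
have fc : fcycle s (traject s v n).
  have [m En] : exists m, n = m.+1 by exists n.-1; rewrite (ltn_predK n2).
  have E : iter m.+1 s v = v by rewrite -En; apply: iter_porbit.
  rewrite En trajectS /= -{3}E iterSr -trajectSr.
  exact: fpath_traject.
exists (traject s v n); split => //.
- by rewrite size_traject.
- apply/andP; split; last exact: uniq_traject_porbit.
  apply: (@sub_in_cycle _ (mem (porbit s v)) (frel s) adj _ _ _ fc); last first.
    by apply/allP => u; rewrite memc.
  move=> a b aP _ /= /eqP <-; apply: conf_adj => //.
  rewrite (sfix_porbit aP); by apply: contraNneq cv => E; rewrite !E.
- by move=> u uc; apply: nextE.
Qed.


Lemma path_all_closed (T : eqType) (e : rel T) (Q : pred T) x p :
  (forall a b, e a b -> Q a -> Q b) -> Q x -> path e x p -> all Q p.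
Proof.
move=> h; elim: p x => //= y p IH x Qx /andP [exy pyp].
have Qy := h _ _ exy Qx; by rewrite Qy (IH y).
Qed.

(** At each node of [c] the two cycle edges are half-edges with different other ends, so they are
    the [s]-edges out of and into that node. Hence [c] runs through one orbit of [s], in one of the
    two orientations. *)
Lemma half_cycle_orbit (C : {set edge adj}) : C \in half_cycles (xv s) ->
  exists2 O, O \in long_orbits & C = orbit_edges O.
Proof.
rewrite inE => /andP [/subsetP sC /asboolP [c [sz /andP [cc uc] EC]]].
have memC e : (e \in C) = (val e \in [set [set v; next c v] | v in c]).
  by rewrite -EC mem_imset //; apply: val_inj.
have nxt v : v \in c -> (s v = next c v \/ next c v = s^-1%g v) /\ s (s v) != v.
  move=> vc; have av : adj v (next c v) by apply: next_cycle.
  have [e Ee] := adj_edge adj_sym av.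
  have eC : e \in C by rewrite memC Ee; apply/imsetP; exists v.
  apply: half_edge => //; rewrite (ev_edge _ Ee).
  by have := sC e eC; rewrite inE => /eqP.
(* If both cycle edges at [v] were the step of [s] into [v], the nodes before and after [v] on [c]
   would coincide, against [next_next_neq]. *)
have prv v : v \in c -> s v = next c v \/ s v = prev c v.
  move=> vc; have pc : prev c v \in c by rewrite mem_prev.
  have [[h1|h1] _] := nxt v vc; first by left.
  have [[h2|h2] _] := nxt _ pc; rewrite next_prev // in h2.
    case/negP: (next_next_neq uc sz pc); rewrite next_prev // h1.
    by rewrite -{1}h2 permK.
  by right; rewrite {1}h2 permKV.
have clc v : v \in c -> s v \in c.
  by move=> vc; case: (prv v vc) => ->; rewrite ?mem_next ?mem_prev.
have [v0 v0c] : exists v, v \in c.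
  by case: (c) sz => [|v l] // _; exists v; rewrite inE eqxx.
have sub1 v : v \in porbit s v0 -> v \in c.
  have cl u : u \in [set v in c] -> s u \in [set v in c] by rewrite !inE; apply: clc.
  have v0S : v0 \in [set v in c] by rewrite inE.
  by move=> /(subsetP (porbit_sub cl v0S)); rewrite inE.
have sub2 v : v \in c -> v \in porbit s v0.
  move=> vc; have [i p E] := rot_to v0c.
  have cn : path (frel (next c)) v0 (rcons p v0).
    by have := cycle_next uc; rewrite -(rot_cycle i) E.
  pose Q := [pred u | (u \in c) && (u \in porbit s v0)].
  have : all Q (rcons p v0).
    apply: path_all_closed cn => [a b /= /eqP <- /andP [ac aP]|]; last by rewrite /= v0c porbit_id.
    rewrite mem_next ac /=; have [[<-|->] _] := nxt a ac.
      by rewrite mem_porbit_step.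
    by rewrite mem_porbit_inv.
  have : v \in rcons p v0 by rewrite mem_rcons -E mem_rot.
  by move=> vp /allP /(_ _ vp) /andP [].
exists (porbit s v0).
  rewrite inE imset_f //= ltnNge card_porbit_le2.
  by case: (nxt v0 v0c).
apply/setP => e; rewrite memC; apply/imsetP/orbit_edgesP => [[v vc E]|[v vP E]].
  have [[h|h] _] := nxt v vc; first by exists v; rewrite ?sub2 // h.
  exists (s^-1%g v); first by rewrite mem_porbit_inv sub2.
  by rewrite permKV E h setUC.
have vc := sub1 v vP; case: (prv v vc) => h; first by exists v; rewrite // -h.
by exists (prev c v); rewrite ?mem_prev // next_prev // -h E setUC.
Qed.

Lemma orbit_half_cycle O : O \in long_orbits -> orbit_edges O \in half_cycles (xv s).
Proof.
rewrite inE => /andP [/imsetP [v _ ->]]; rewrite ltnNge card_porbit_le2 => cv.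
have nf u : u \in porbit s v -> s u != u.
  by move=> uP; rewrite (sfix_porbit uP); apply: contraNneq cv => E; rewrite !E.
rewrite inE; apply/andP; split.
  apply/subsetP => e /orbit_edgesP [u uP E]; rewrite inE -(ev_edge _ E).
  rewrite ev_xv_adj //; last exact: conf_adj cs (nf u uP).
  by rewrite eqxx (sinv_porbit uP) (negbTE cv) addr0 mul1r.
apply/asboolP; have [c [sz uc memc nx]] := long_orbit_cycle cv; exists c; split => //.
apply/setP => A; apply/imsetP/imsetP => [[e /orbit_edgesP [u uP E] ->]|[u uc' ->]].
  by exists u; rewrite ?memc // nx ?memc.
rewrite nx //; rewrite memc in uc'.
have au : adj u (s u) by apply: conf_adj cs (nf u uc').
have [e E] := adj_edge adj_sym au; exists e => //; by apply/orbit_edgesP; exists u.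
Qed.

Lemma card_half_cycles : #|half_cycles (xv s)| = #|long_orbits|.
Proof.
rewrite -(@card_in_imset _ _ orbit_edges); last first.
  move=> O1 O2; rewrite !inE => /andP [/imsetP [v _ ->] n1] /andP [/imsetP [w _ ->] _] E.
  have cv : s (s v) != v by rewrite -card_porbit_le2 -ltnNge.
  have nv : s v != v by apply: contraNneq cv => F; rewrite !F.
  have [e Ee] := adj_edge adj_sym (conf_adj cs nv).
  have : e \in orbit_edges (porbit s v) by apply/orbit_edgesP; exists v; rewrite ?porbit_id.
  rewrite E => /orbit_edgesP [u uw]; rewrite Ee => /set2_eq [] [h _]; apply: porbit_trans.
    by rewrite h.
  by rewrite h mem_porbit_step.
apply: eq_card => C; apply/idP/imsetP => [/half_cycle_orbit [O h1 h2]|[O h ->]].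
  by exists O.
exact: orbit_half_cycle.
Qed.

(** The coordinate sum is half the number of covered nodes, and the cycles are counted by giving
    each node of a cycle of length [n] the share [1 / n]. *)
Lemma score_xv : \sum_(e : edge adj) xv s e + #|half_cycles (xv s)|%:R / 2 = score R s.
Proof.
have -> : \sum_(e : edge adj) xv s e = \sum_v (s v != v)%:R / 2.
  rewrite -mulr_suml -(eq_bigr _ (fun v _ => deg_xv R adj_sym adj_irr v cs)) sum_deg //.
  by rewrite [RHS]mulrC mulKf // pnatr_eq0.
have -> : #|half_cycles (xv s)|%:R =
    \sum_v (if s (s v) != v then #|porbit s v|%:R^-1 else 0) :> R.
  rewrite card_half_cycles -big_mkcond (partition_big (porbit s) (mem long_orbits)) /=.
    rewrite -sum1_card natr_sum; apply: eq_bigr => O; rewrite inE => /andP [/imsetP [v _ ->] n2].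
    have cv : s (s v) != v by rewrite -card_porbit_le2 -ltnNge.
    rewrite (eq_bigl (fun u => u \in porbit s v)) => [|u]; last first.
      rewrite -eq_porbit_mem; case: (porbit s u =P porbit s v) => [h|_]; rewrite ?andbF // andbT.
      by rewrite -card_porbit_le2 h card_porbit_le2.
    rewrite (eq_bigr (fun=> #|porbit s v|%:R^-1)) => [|u uP]; last by rewrite (porbit_trans uP).
    rewrite big_const iter_addr_0 -[RHS]mulr_natl mulfV // pnatr_eq0 -lt0n card_porbit_gt0 //.
  by move=> v cv; rewrite inE imset_f //= ltnNge card_porbit_le2.
rewrite mulr_suml -big_split /=; apply: eq_bigr => v _.
have [cv|cv] := boolP (s (s v) != v).
  have nv : s v != v by apply: contraNneq cv => F; rewrite !F.
  by rewrite weight_cycle // nv mulrDl.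
rewrite mul0r addr0; have [E|nv] := eqVneq (s v) v; first by rewrite weight_fixed // mul0r.
by rewrite weight_pair ?mul1r //; apply/eqP; rewrite negbK in cv.
Qed.

End HalfCycles.

(** * The lower bound *)

Lemma underdetermined (F : fieldType) (I J : finType) (A : {set I}) (B : {set J})
    (M : I -> J -> F) : (#|B| < #|A|)%N ->
  exists d : I -> F, [/\ forall i, i \notin A -> d i = 0, exists i, d i != 0 &
    forall j, j \in B -> \sum_i d i * M i j = 0].
Proof.
move=> lt; pose m := \matrix_(i < #|A|, j < #|B|) M (enum_val i) (enum_val j).
have : kermx m != 0.
  rewrite kermx_eq0 /row_free neq_ltn; apply/orP; left.
  exact: leq_ltn_trans (rank_leq_col m) lt.
move=> /rowV0Pn [w /sub_kermxP wm nw].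
pose d i := if [pick k : 'I_#|A| | enum_val k == i] is Some k then w 0 k else 0.
have dE k : d (enum_val k) = w 0 k.
  rewrite /d; case: pickP => [l /eqP /enum_val_inj -> //|/(_ k)].
  by rewrite eqxx.
exists d; split.
- move=> i iA; rewrite /d; case: pickP => // k /eqP E.
  by have := enum_valP k; rewrite E (negbTE iA).
- have [k nk] : exists k, w 0 k != 0.
    apply: contrapT => h; move/eqP: nw; apply; apply/rowP => k; rewrite mxE.
    by apply/eqP; apply: contraT => nk; case: h; exists k.
  by exists (enum_val k); rewrite dE.
- move=> j jB; have := congr1 (fun u : 'rV_#|B| => u 0 (enum_rank_in jB j)) wm.
  rewrite !mxE => {2}<-; rewrite (bigID (mem A)) /= [X in _ + X]big1 ?addr0 => [|i iA].
    rewrite big_enum_val /=; apply: eq_bigr => k _.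
    by rewrite dE mxE enum_rankK_in.
  rewrite /d; case: pickP => [k /eqP E|_]; last by rewrite mul0r.
  by have := enum_valP k; rewrite E (negbTE iA).
Qed.

Section Lower.
Variables (R : realType) (V : finType) (adj : rel V).
Hypotheses (adj_sym : symmetric adj) (adj_irr : irreflexive adj).
Notation vec := (vect R (edge adj)).
Notation P := (@frac_matching_polytope R V adj).
Notation xv := (@xv R V adj).
Notation weight := (weight R).
Variables s t : {perm V}.
Hypotheses (cs : conf adj s) (ct : conf adj t) (st : skel_adj P (xv s) (xv t)).

Let m : vec := mid (xv s) (xv t).

Let ps : P (xv s). Proof. exact: fmp_xv. Qed.
Let pt : P (xv t). Proof. exact: fmp_xv. Qed.
Let pm : P m. Proof. exact: mid_fmp. Qed.

Definition joint_edges (A : {set V}) : {set edge adj} :=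
  [set e : edge adj | (val e \subset A) && (m e != 0)].

(** Over a set closed under [t] this sums to the number of nodes plus the number of long cycles of
    [t]. It equals twice [weight] except at fixed nodes, where it is 1 instead of 0. *)
Definition node_weight v : R :=
  1 + (if t (t v) != v then #|porbit t v|%:R^-1 else 0).

Lemma ev_mid u v : ev m u v = (ev (xv s) u v + ev (xv t) u v) / 2.
Proof. by rewrite evZ evD mulrC. Qed.

Lemma mid_step_t v : t v != v -> ev m v (t v) != 0.
Proof.
move=> nv; rewrite ev_mid gt_eqF // divr_gt0 ?ltr0n //.
rewrite ltr_wpDl ?ev_ge0 // ev_xv_adj ?conf_adj // eqxx divr_gt0 ?ltr0n //.
by rewrite ltr_wpDr ?ler0n ?ltr01.
Qed.

Lemma mid_step_s v : s v != v -> ev m v (s v) != 0.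
Proof.
move=> nv; rewrite ev_mid gt_eqF // divr_gt0 ?ltr0n //.
rewrite ltr_wpDr ?ev_ge0 // ev_xv_adj ?conf_adj // eqxx divr_gt0 ?ltr0n //.
by rewrite ltr_wpDr ?ler0n ?ltr01.
Qed.

Lemma mid_edge u v : ev m u v != 0 -> exists2 e : edge adj, val e = [set u; v] & m e != 0.
Proof.
move=> n; have uv : adj u v by apply: contraNT n => h; rewrite ev_nadj.
by have [e E] := adj_edge adj_sym uv; exists e => //; rewrite -(ev_edge m E).
Qed.

(** An orbit of one or two nodes has one node more than edges of [t]. A long cycle has as many edges
    as nodes, and its shares [1 / n] add up to the extra 1. *)
Lemma orbit_joint_edges v :
  \sum_(u in porbit t v) node_weight u <= #|joint_edges (porbit t v)|%:R + 1.
Proof.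
set O := porbit t v; have oE u : u \in O -> porbit t u = O by apply: porbit_trans.
have [fv|nv] := eqVneq (t v) v.
  have -> : O = [set v] by rewrite /O porbit_pair fv // setUid.
  by rewrite big_set1 /node_weight !fv eqxx addr0 lerDr.
have sub : [set [set u; t u] | u in O] \subset [set val e | e in joint_edges O].
  apply/subsetP => B /imsetP [u uO ->].
  have nu : t u != u by rewrite (sfix_porbit uO).
  have [e E ne] := mid_edge (mid_step_t nu); apply/imsetP; exists e => //.
  rewrite inE ne andbT E; apply/subsetP => w; rewrite !inE.
  by move=> /pred2P [] ->; rewrite ?mem_porbit_step.
have := subset_leq_card sub; rewrite (card_imset _ val_inj) => le.
have [pv|cv] := eqVneq (t (t v)) v.
  rewrite (eq_bigr (fun=> 1)) => [|u uO]; last first.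
    by rewrite /node_weight (sinv_porbit uO) pv eqxx addr0.
  have cO : #|O| = 2 by rewrite /O (porbit_pair pv) cards2 eq_sym nv.
  rewrite sumr_const cO natr1 ler_nat ltnS; apply: leq_trans le; apply/card_gt0P.
  by exists [set v; t v]; apply/imsetP; exists v; rewrite ?porbit_id.
rewrite card_in_imset in le; last first.
  move=> u w uO wO /set2_eq [[h _]|[h1 h2]] //.
  by have := cv; rewrite -(sinv_porbit wO) -h1 h2 eqxx.
rewrite (eq_bigr (fun=> 1 + #|O|%:R^-1)) => [|u uO]; last first.
  by rewrite /node_weight (sinv_porbit uO) cv oE.
rewrite big_const iter_addr_0 -[leLHS]mulr_natl mulrDr mulr1 mulfV ?lerD2r ?ler_nat //.
by rewrite pnatr_eq0 -lt0n card_porbit_gt0.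
Qed.

Variables (e0 : edge adj) (r r' : V).
Hypotheses (ne0 : xv s e0 <> xv t e0) (re0 : val e0 = [set r; r']).

(* [A] is grown by whole orbits of [t]: an orbit with [n] nodes brings [n - 1]
   edges, or [n] edges if it is a long cycle, and the edge joining it to [A]. *)
Definition grown (A : {set V}) := [&& [forall v in A, t v \in A], r \in A &
  \sum_(u in A) node_weight u <= #|joint_edges A|%:R + 1].

Lemma grown_orbit : grown (porbit t r).
Proof.
apply/and3P; split; [|exact: porbit_id|exact: orbit_joint_edges].
by apply/forall_inP => v; apply: porbit_closed.
Qed.

(** The edge joining the two parts offsets the second [+ 1] when their bounds are added. *)
Lemma grown_extend A a b : grown A -> a \in A -> b \notin A -> ev m a b != 0 ->
  grown (A :|: porbit t b).
Proof.
move=> /and3P [/forall_inP clA rA le] aA bA ab.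
have dis u : u \in porbit t b -> u \notin A.
  move=> ub; apply: contra bA => uA; apply: (subsetP (porbit_sub clA uA)).
  by rewrite porbit_sym.
apply/and3P; split.
- apply/forall_inP => v; rewrite !inE mem_porbit_step => /orP [/clA ->|->] //.
  by rewrite orbT.
- by rewrite inE rA.
rewrite (eq_bigl [in [predU A & porbit t b]]) => [|u]; last by rewrite !inE.
rewrite bigU /=; last first.
  rewrite disjoint_sym disjoint_subset; apply/subsetP => u /dis; by rewrite inE.
apply: le_trans (lerD le (orbit_joint_edges b)) _.
suff : (#|joint_edges A| + #|joint_edges (porbit t b)| + 1 <=
        #|joint_edges (A :|: porbit t b)|)%N.
  by rewrite -(ler_nat R) !natrD; lra.
have [e E me] := mid_edge ab.
set B := A :|: _.
have sub : e |: (joint_edges A :|: joint_edges (porbit t b)) \subset joint_edges B.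
  apply/subsetP => f; rewrite !inE => /or3P [/eqP ->|/andP [h ->]|/andP [h ->]].
  - rewrite me andbT E; apply/subsetP => w; rewrite !inE => /pred2P [] ->.
      by rewrite aA.
    by rewrite porbit_id orbT.
  - by rewrite andbT (subset_trans h) // subsetUl.
  - by rewrite andbT (subset_trans h) // subsetUr.
have := subset_leq_card sub; rewrite cardsU1 cardsU.
have -> : joint_edges A :&: joint_edges (porbit t b) = set0.
  apply/setP => f; rewrite !inE; apply/negP => /andP [/andP [h1 _] /andP [h2 _]].
  have [u [w [_ Ef]]] := edge_ends f.
  have uf : u \in val f by rewrite Ef !inE eqxx.
  by have := dis u (subsetP h2 _ uf); rewrite (subsetP h1 _ uf).
have -> : e \notin joint_edges A :|: joint_edges (porbit t b).
  have ae : a \in val e by rewrite E !inE eqxx.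
  have be : b \in val e by rewrite E !inE eqxx orbT.
  rewrite !inE me !andbT negb_or; apply/andP; split.
    by apply: contra bA => /subsetP; apply.
  by apply/negP => /subsetP /(_ _ ae) /dis; rewrite aA.
by rewrite cards0 subn0 addn1 add1n.
Qed.

Lemma grown_max : exists2 A, grown A &
  forall a b, a \in A -> b \notin A -> ev m a b = 0.
Proof.
have [A /maxsetP [gA mx]] := ex_maxset (ex_intro (fun A => grown A) _ grown_orbit).
exists A => // a b aA bA; apply/eqP; apply: contraT => ab.
have := mx _ (grown_extend gA aA bA ab) (subsetUl _ _) => /setP /(_ b).
by rewrite !inE porbit_id (negbTE bA).
Qed.

Lemma kernel_zero d : kernel m d -> d e0 = 0 -> d = 0.
Proof. exact: (adj_kernel adj_irr st ne0). Qed.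

Lemma tight_covered v : deg m v = 1 -> s v != v.
Proof.
move=> /(mid_tight adj_irr ps pt) [h _]; move: h; rewrite deg_xv //.
by case: eqP => // _ /eqP; rewrite eq_sym oner_eq0.
Qed.

Section Component.
Variable A : {set V}.
Hypotheses (gA : grown A) (sepA : forall a b, a \in A -> b \notin A -> ev m a b = 0).

Let rA : r \in A. Proof. by case/and3P: gA. Qed.

Lemma edge_inside (e : edge adj) : val e \subset A \/ (forall v, v \in val e -> v \in A -> m e = 0).
Proof.
have [u [w [uw E]]] := edge_ends e.
case: (boolP (u \in A)) => uA; case: (boolP (w \in A)) => wA.
- by left; rewrite E; apply/subsetP => v; rewrite !inE => /pred2P [] ->.
- by right => _ _ _; rewrite -(ev_edge m E) sepA.
- by right => _ _ _; rewrite -(ev_edge m E) ev_sym sepA.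
- right => v; rewrite E !inE => /pred2P [] -> h; by rewrite h in uA wA.
Qed.

Let me0 : m e0 != 0.
Proof. by apply/eqP => /(mid_zero adj_irr ps pt) [h1 h2]; apply: ne0; rewrite h1 h2. Qed.

Lemma e0_inside : val e0 \subset A.
Proof.
case: (edge_inside e0) => // /(_ r); rewrite re0 !inE eqxx => /(_ isT rA) E.
by move: me0; rewrite E eqxx.
Qed.

(** The difference of the two vectors, cut off to the edges not inside [A], is still a kernel
    direction because no joint edge leaves [A]. It vanishes at [e0], so adjacency makes it zero. *)
Lemma same_outside (e : edge adj) : ~~ (val e \subset A) -> xv s e = xv t e.
Proof.
pose d : vec := [ffun e : edge adj => if val e \subset A then 0 else xv t e - xv s e].
have [k1 k2] : kernel m (xv t - xv s).
  by have [ms mt] := mid_min_face adj_irr ps pt; apply: min_face_diff ms mt.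
suff d0 : d = 0.
  move=> nA; have := congr1 (fun f : vec => f e) d0; rewrite !ffunE (negbTE nA).
  by move=> /eqP; rewrite subr_eq0 => /eqP.
apply: kernel_zero; last by rewrite ffunE e0_inside.
split => [e' h|v dv].
  by rewrite ffunE; case: ifP => // _; have := k1 e' h; rewrite !ffunE.
rewrite degE //; case: (boolP (v \in A)) => vA.
  apply: big1 => e' ve; rewrite ffunE; case: ifP => // nA.
  case: (edge_inside e') => [|/(_ v ve vA) h]; first by rewrite nA.
  by have := k1 e' h; rewrite !ffunE.
have := k2 v dv; rewrite degE // => E; rewrite -[RHS]E; apply: eq_bigr => e' ve.
rewrite !ffunE; case: ifP => // sA.
by move: vA; rewrite (subsetP sA).
Qed.

(** Otherwise the joint edges in [A] would carry a nonzero direction with zero sum at all tight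
    nodes and zero value at [e0], contradicting adjacency. *)
Lemma card_joint_edges : (#|joint_edges A| <= #|[set v in A | deg m v == 1%R]| + 1)%N.
Proof.
set T := [set v in A | deg m v == 1]; rewrite leqNgt; apply/negP => lt.
(* The index [None] stands for the extra equation that the value at [e0] is zero. *)
pose B : {set option V} := None |: (Some @: T).
pose M (e : edge adj) (j : option V) : R :=
  if j is Some v then (v \in val e)%:R else (e == e0)%:R.
have cB : #|B| = (#|T| + 1)%N.
  have nN : None \notin [set Some v | v in T] by apply/imsetP => -[].
  by rewrite cardsU1 nN card_imset 1?addnC // => u v [].
have [|d [d0 [i di] dM]] := @underdetermined R _ _ (joint_edges A) B M; first by rewrite cB.
pose d' : vec := [ffun e => d e].
suff E : d' = 0 by move: di; have := congr1 (fun f : vec => f i) E; rewrite !ffunE => ->; rewrite eqxx.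
apply: kernel_zero; last first.
  have := dM None; rewrite !inE => /(_ isT); rewrite (bigD1 e0) //= eqxx mulr1 big1 ?addr0 ?ffunE //.
  by move=> e /negbTE ->; rewrite mulr0.
split => [e h|v dv].
  by rewrite ffunE d0 // inE h eqxx andbF.
rewrite degE //; case: (boolP (v \in A)) => vA.
  have := dM (Some v); rewrite !inE (mem_imset _ _ (@Some_inj _)) inE vA dv eqxx => /(_ isT) E.
  rewrite -[RHS]E [LHS]big_mkcond /=; apply: eq_bigr => e _; rewrite ffunE.
  by case: ifP => _; rewrite ?mulr1 ?mulr0.
apply: big1 => e ve; rewrite ffunE d0 // inE negb_and; apply/orP; left.
by apply: contra vA => /subsetP; apply.
Qed.

(** Both vectors agree at the nodes outside [A] and so determine the same orbits there. Only the
    orientation may differ, which the weight ignores. *)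
Lemma weight_outside v : v \notin A -> weight #|porbit s v| = weight #|porbit t v|.
Proof.
move=> vA; have clT u : u \in A -> t u \in A by case/and3P: gA => /forall_inP h _ _; apply: h.
have clS u : u \in A -> s u \in A.
  move=> uA; apply: contraT => n; have nu : s u != u by apply: contraNneq n => ->.
  by have := mid_step_s nu; rewrite sepA ?eqxx.
have eqev u w : u \notin A -> adj u w -> ev (xv s) u w = ev (xv t) u w.
  move=> uA uw; have [e E] := adj_edge adj_sym uw; rewrite !(ev_edge _ E).
  apply: same_outside; apply: contra uA => /subsetP; apply; by rewrite E !inE eqxx.
have stepin (x y : {perm V}) u : conf adj x -> conf adj y ->
    (forall w, adj u w -> ev (xv x) u w = ev (xv y) u w) -> x u \in porbit y u.
  move=> cx cy h; have [->|nu] := eqVneq (x u) u; first exact: porbit_id.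
  have := h _ (conf_adj cx nu); rewrite !ev_xv_adj ?conf_adj // eqxx.
  case: (y u =P x u) => [<-|_]; first by rewrite mem_porbit1.
  case: (y (x u) =P u) => [E _|_]; first by rewrite porbit_sym -[X in X \in _]E mem_porbit1.
  by case: (_ == _) => /=; lra.
congr (weight #|pred_of_set _|); apply/eqP; rewrite eqEsubset; apply/andP; split.
  apply: (@porbit_sub_on _ s t (~: A)); rewrite ?inE //; first exact: closedC.
  by move=> u; rewrite inE => uA; apply: stepin => // w; apply: eqev.
apply: (@porbit_sub_on _ t s (~: A)); rewrite ?inE //; first exact: closedC.
by move=> u; rewrite inE => uA; apply: stepin => // w uw; rewrite eqev.
Qed.

(** On [A], twice the score of [t] is at most the sum of node weights, hence at most the number of
    joint edges plus 1, hence at most the number of tight nodes plus 2. Each tight node is covered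
    by [s] and adds at least 1 to twice the score of [s]. *)
Lemma score_component : score R t <= score R s + 1.
Proof.
rewrite /score (bigID (mem A)) /= [in leRHS](bigID (mem A)) /=.
rewrite (eq_bigr _ weight_outside) addrAC lerD2r.
have le1 : \sum_(v in A) weight #|porbit t v| * 2 <= \sum_(v in A) node_weight v.
  apply: ler_sum => v _; rewrite /node_weight.
  have [cv|cv] := boolP (t (t v) != v); first by rewrite weight_cycle // divfK // pnatr_eq0.
  have [fv|nv] := eqVneq (t v) v; first by rewrite weight_fixed // mul0r addr0.
  by rewrite negbK in cv; rewrite weight_pair ?(eqP cv) // mulVf ?addr0 // pnatr_eq0.
have le2 : \sum_(v in A) node_weight v <= #|joint_edges A|%:R + 1 by case/and3P: gA.
have le3 : #|joint_edges A|%:R <= #|[set v in A | deg m v == 1]|%:R + 1 :> R.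
  by rewrite natr1 ler_nat -addn1 card_joint_edges.
have le4 : #|[set v in A | deg m v == 1]|%:R <= \sum_(v in A) weight #|porbit s v| * 2.
  rewrite -sum1_card natr_sum (eq_bigl (fun v => (v \in A) && (deg m v == 1))) => [|v]; last by rewrite inE.
  rewrite big_mkcondr /=; apply: ler_sum => v _; case: ifP => [/eqP dv|_]; last first.
    by rewrite mulr_ge0 ?weight_ge0.
  rewrite -ler_pdivrMr ?ltr0n // mul1r; apply: weight_ge_half.
  by rewrite ltnNge card_porbit_le1 tight_covered.
rewrite -!mulr_suml in le1 le4; lra.
Qed.

End Component.
End Lower.

Lemma score_adj (R : realType) (V : finType) (adj : rel V) (s t : {perm V}) :
  symmetric adj -> irreflexive adj -> conf adj s -> conf adj t ->
  skel_adj (@frac_matching_polytope R V adj) (xv R adj s) (xv R adj t) ->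
  score R t <= score R s + 1.
Proof.
move=> asym airr cs ct st; have [_ _ ne _] := st.
have [e0 ne0] : exists e, xv R adj s e <> xv R adj t e.
  by apply: contrapT => h; apply: ne; apply/ffunP => e; apply: contrapT => n; apply: h; exists e.
have [r [r' [_ E]]] := edge_ends e0.
have [A gA sep] := grown_max R asym airr cs ct r.
exact: (score_component asym airr cs ct st ne0 E gA sep).
Qed.

Theorem theorem1 (R : realType) (V : finType) (adj : rel V)
    (adj_sym : symmetric adj) (adj_irr : irreflexive adj) :
  exists d : nat,
    is_comb_diameter (@frac_matching_polytope R V adj) d /\
    is_max_over (is_vertex (@frac_matching_polytope R V adj))
      (fun x : vect R (edge adj) =>
         (\sum_(e : edge adj) x e) + #|half_cycles x|%:R / 2)
      (d%:R : R).
Proof.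
pose P := @frac_matching_polytope R V adj; pose X := @xv R V adj.
(* A step raises the score by at most 1, and each intermediate point is a vertex, hence given by a
   configuration. *)
have lower k s t : conf adj s -> conf adj t -> skel_walk P (X s) (X t) k ->
    score R t <= score R s + k%:R.
  move=> cs ct [p [pp lp sp]]; elim: p k s cs pp lp sp => [|y p IH] k s cs /=.
    move=> _ Exy <-; rewrite addr0 -!(score_xv R adj_sym adj_irr) //.
    by rewrite -/(X s) Exy.
  move=> /andP [/asboolP sy pp] lp <-.
  have [_ vy _ _] := sy; have [u cu Eu] := vertex_conf adj_sym adj_irr vy; subst y.
  have := IH _ u cu pp lp erefl; have := score_adj adj_sym adj_irr cs cu sy.
  by rewrite -natr1; lra.
pose r := [arg max_(r > 1%g | conf adj r) score R r]%O.
have [cr mx] : conf adj r /\ forall q, conf adj q -> score R q <= score R r.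
  by rewrite /r; case: Order.TotalTheory.arg_maxP => //; apply: conf1.
have [q [d [cq wd sd]]] := conf_walk R adj_sym adj_irr (conf1 adj) cr.
(* The walk from the origin to [r] has at least [score R r] and at most [score R q] steps.
   Maximality of [r] closes the gap and shows that the maximum is a natural number. *)
have Ed : score R r = d%:R.
  apply/eqP; rewrite eq_le (le_trans sd (mx _ cq)) andbT.
  by have := lower _ _ _ (conf1 adj) cr wd; rewrite score1 add0r.
exists d; split; last first.
  split; first by exists (X r); [exact: conf_vertex | rewrite score_xv].
  by move=> x /(vertex_conf adj_sym adj_irr) [s cs ->]; rewrite score_xv // -Ed mx.
split.
  exists (X 1%g), (X r); split; [exact: conf_vertex (conf1 adj) | exact: conf_vertex |].
  split => // k /(lower _ _ _ (conf1 adj) cr); by rewrite Ed score1 add0r ler_nat.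
move=> u v /(vertex_conf adj_sym adj_irr) [s cs ->] /(vertex_conf adj_sym adj_irr) [t ct ->].
have [q' [l [cq' wl sl]]] := conf_walk R adj_sym adj_irr cs ct.
have ld : (l <= d)%N by rewrite -(ler_nat R) -Ed (le_trans sl) // mx.
have ex : exists k, `[< skel_walk P (X s) (X t) k >] by exists l; apply/asboolP.
have [k /asboolP wk mk] := ex_minnP ex.
exists k; last by apply: leq_trans ld; apply: mk; apply/asboolP.
by split => // j wj; apply: mk; apply/asboolP.
Qed.
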